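(* Consider the nonlinear Riccati equation, with constants $P$ and $Q$, $$ {}^{ABC}D^{\alpha}_{0+}f(t)=P+Q\big(f(t)\big)^2,\qquad f(0)=f_0, $$ and the possibility of a convergent series solution of the form $$ f(t)=\sum_{k=0}^{\infty}a_kt^{k\alpha}. $$ The equation has a solution of this form with the coefficients $a_k$ defined to satisfy $$ 0=P+Qa_0^2,\qquad \frac{B(\alpha)}{1-\alpha}\sum_{k=1}^{m}a_k\Big(\frac{-\alpha}{1-\alpha}\Big)^{m-k}\frac{\Gamma(k\alpha+1)}{\Gamma(m\alpha+1)}=Q\sum_{k=0}^{m}a_ka_{m-k}\quad\text{for all } m>0. $$ These identities can be solved for each $m$ in turn to find all the coefficients: $a_0=\pm\sqrt{-P/Q}$ and, for $m>0$, $$ a_m=\frac{\frac{B(\alpha)}{1-\alpha}\sum_{k=1}^{m-1}a_k\left(\frac{-\alpha}{1-\alpha}\right)^{m-k}\frac{\Gamma(k\alpha+1)}{\Gamma(m\alpha+1)}-Q\sum_{k=1}^{m-1}a_ka_{m-k}}{2Qa_0-\frac{B(\alpha)}{1-\alpha}}. $$ Thus the general solution of this form to the Riccati equation is $$ f(t)=\sqrt{\frac{-P}{Q}}+\sum_{m=1}^{\infty}\frac{\frac{B(\alpha)}{1-\alpha}\sum_{k=1}^{m-1}a_k\left(\frac{-\alpha}{1-\alpha}\right)^{m-k}\frac{\Gamma(k\alpha+1)}{\Gamma(m\alpha+1)}-Q\sum_{k=1}^{m-1}a_ka_{m-k}}{2Qa_0-\frac{B(\alpha)}{1-\alpha}}\,t^{m\alpha}.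 $$
   Context: The Mittag-Leffler function is $E_\alpha(x)=\sum_{n=0}^\infty \frac{x^n}{\Gamma(\alpha n+1)}$. $B$ is a fixed normalisation function with real, strictly positive values and $B(0)=B(1)=1$. For $0<\alpha<1$ the ABC fractional derivative is $$ {}^{ABC}D^{\alpha}_{0+}f(t)=\frac{B(\alpha)}{1-\alpha}\int_0^t f'(x)E_\alpha\Big(\frac{-\alpha}{1-\alpha}(t-x)^{\alpha}\Big)\,\mathrm{d}x. $$ *)

(* Defs.v *)
From HB Require Import structures.
From mathcomp Require Import all_boot all_order all_algebra.
From mathcomp Require Import all_classical all_reals all_analysis.
From mathcomp Require Import complex.

Set Implicit Arguments.
Unset Strict Implicit.
Unset Printing Implicit Defensive.

Import Order.TTheory GRing.Theory Num.Theory numFieldNormedType.Exports.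

Local Open Scope classical_set_scope.
Local Open Scope ring_scope.
Local Open Scope complex_scope.

(* Euler's integral; only its values at x > 0 are meaningful. *)
Definition Gamma (R : realType) (x : R) : R :=
  \int[lebesgue_measure]_(t in `]0, +oo[) (t `^ (x - 1) * expR (- t)).

Definition mittag_leffler (R : realType) (alpha x : R) : R :=
  limn (series (fun n : nat => x ^+ n / Gamma (alpha * n%:R + 1))).

Definition ABC_derive_real (R : realType) (B : R -> R) (alpha : R)
    (f : R -> R) (t : R) : R :=
  B alpha / (1 - alpha) *
  \int[lebesgue_measure]_(x in `[0, t])
     (derive1 f x *
      mittag_leffler alpha (- alpha / (1 - alpha) * (t - x) `^ alpha)).

(* The kernel is real, so the ABC derivative of a complex-valued function of a
   real variable is computed on its real and imaginary parts. *)
Definition ABC_derive (R : realType) (B : R -> R) (alpha : R)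
    (f : R -> R[i]) (t : R) : R[i] :=
  ABC_derive_real B alpha (fun x => complex.Re (f x)) t +i*
  ABC_derive_real B alpha (fun x => complex.Im (f x)) t.

(* [derive1] and the integral are total functions: this is the condition under
   which the value of [ABC_derive_real] on ]0, T[ is not a default value. *)
Definition ABC_derivable_real (R : realType) (T : R) (f : R -> R) : Prop :=
  (forall t, 0 < t < T -> derivable f t 1) /\
  (forall t, 0 < t < T ->
     lebesgue_measure.-integrable `[0, t] (fun x => (derive1 f x)%:E)).

Definition ABC_derivable (R : realType) (T : R) (f : R -> R[i]) : Prop :=
  ABC_derivable_real T (fun x => complex.Re (f x)) /\
  ABC_derivable_real T (fun x => complex.Im (f x)).

Definition riccati_solution (R : realType) (B : R -> R) (alpha : R)
    (P Q f0 : R[i]) (T : R) (f : R -> R[i]) : Prop :=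
  [/\ f 0 = f0,
      ABC_derivable T f &
      forall t, 0 < t < T -> ABC_derive B alpha f t = P + Q * f t ^+ 2].

(* Convergence is for the topology of the normed field R[i], which the library
   attaches to its regular algebra R[i]^o.  Since 0 `^ 0 = 1 and 0 `^ r = 0 for
   r > 0, the sum at t = 0 is a 0. *)
Definition frac_series_on (R : realType) (alpha : R) (a : nat -> R[i]) (T : R)
    (f : R -> R[i]) : Prop :=
  forall t : R, 0 <= t < T ->
    series (fun k : nat => a k * (t `^ (k%:R * alpha))%:C : R[i]^o) @ \oo
      --> (f t : R[i]^o).

Definition riccati_identity (R : realType) (B : R -> R) (alpha : R)
    (Q : R[i]) (a : nat -> R[i]) (m : nat) : Prop :=
  (B alpha / (1 - alpha))%:C *
    \sum_(1 <= k < m.+1)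
       a k * ((- alpha / (1 - alpha)) ^+ (m - k) *
              (Gamma (k%:R * alpha + 1) / Gamma (m%:R * alpha + 1)))%:C
  = Q * \sum_(0 <= k < m.+1) a k * a (m - k)%N.

Definition riccati_identities (R : realType) (B : R -> R) (alpha : R)
    (P Q : R[i]) (a : nat -> R[i]) : Prop :=
  0 = P + Q * a 0%N ^+ 2 /\
  forall m : nat, (0 < m)%N -> riccati_identity B alpha Q a m.

Definition riccati_coef (R : realType) (B : R -> R) (alpha : R)
    (Q : R[i]) (a : nat -> R[i]) (m : nat) : R[i] :=
  ((B alpha / (1 - alpha))%:C *
     \sum_(1 <= k < m)
        a k * ((- alpha / (1 - alpha)) ^+ (m - k) *
               (Gamma (k%:R * alpha + 1) / Gamma (m%:R * alpha + 1)))%:C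
   - Q * \sum_(1 <= k < m) a k * a (m - k)%N)
  / (2 * Q * a 0%N - (B alpha / (1 - alpha))%:C).

(* Main.v *)
Require Import Defs.
From HB Require Import structures.
From mathcomp Require Import all_boot all_order all_algebra.
From mathcomp Require Import all_classical all_reals all_analysis.
From mathcomp Require Import measurable_realfun complex.
From mathcomp Require Import ring lra.

Set Implicit Arguments.
Unset Strict Implicit.
Unset Printing Implicit Defensive.

Import Order.TTheory GRing.Theory Num.Theory numFieldNormedType.Exports.

Local Open Scope classical_set_scope.
Local Open Scope ring_scope.
Local Open Scope complex_scope.

(** Write [f t = F (t `^ alpha)] with [F] the power series of coefficients [a].
    The proof rests on one computation: the ABC derivative of [f] is again a
    series in the powers [t `^ (m * alpha)], and its [m]-th coefficient is the
    left-hand side of the [m]-th identity ([cvg_ABC_frac_series]).  Since the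
    kernel is real, it is enough to do this for real coefficients
    ([cvg_derive_mittag_leffler_convolution]).  There both [f'] and the
    Mittag-Leffler kernel are absolutely convergent series, so the integrand is
    the limit of the partial sums of their Cauchy product.  These are dominated
    by a constant times [x `^ (alpha - 1)], which is integrable on ]0, t[
    because [alpha > 0]; hence the integral may be taken term by term.  Each
    term is an Euler beta integral, and the relation
    [Gamma p * Gamma q = Gamma (p + q) * Beta p q] ([egammaM]) turns it into the
    quotient of Gamma values of the statement.

    The right-hand side [P + Q * f ^+ 2] is a series in the same powers, by the
    Cauchy product again.  Both sides agree on ]0, T[ iff the two series have
    the same coefficients ([frac_series_eq0_coef]), and the coefficients are
    compared in [riccati_solutionP]: the constant one gives the equation for
    [a 0], the [m]-th one gives the [m]-th identity.

    The remaining claims are algebraic.  In the [m]-th identity the unknown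
    [a m] has the factor [2 * Q * a 0 - B alpha / (1 - alpha)], so the identity
    can be solved for [a m] when this factor is nonzero.  For existence it is
    enough to observe that the sequence with [a k = 0] for all [k > 0] satisfies
    every identity: the constant function with value a root of [P + Q * z ^+ 2]
    is a solution.  When the factor is nonzero this is also the only sequence
    starting at that root, because every term of the recurrence contains some
    [a k] with [0 < k < m] ([riccati_coef_eq0]). *)

(** * Affine changes of variable for the Lebesgue integral *)

(** By uniqueness of the Lebesgue measure: a translation preserves the length of
    intervals, so the image measure is the Lebesgue measure. *)
Lemma lebesgue_shift (R : realType) (b : R) (f : R -> \bar R) :
  measurable_fun setT f -> (forall x, 0 <= f x)%E ->
  (\int[lebesgue_measure]_x f (x + b)%R = \int[lebesgue_measure]_x f x)%E.
Proof.
move=> mf f0.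
pose phi : measurableTypeR R -> measurableTypeR R := fun x => x + b.
have mphi : measurable_fun setT phi by exact: measurable_funD.
pose mu : {measure set (measurableTypeR R) -> \bar R} :=
  measure_function_pushforward__canonical__measure_function_Measure
   (@lebesgue_measure R) mphi.
have muE (A : set (measurableTypeR R)) : measurable A -> lebesgue_measure A = mu A.
  apply: lebesgue_measure_unique => _ [[x y] _ <-] /=.
  rewrite /pushforward.
  rewrite (_ : _ @^-1` _ = `]x - b, y - b]%classic); last first.
    by apply/seteqP; split=> z /=; rewrite !in_itv/= ltrBlDr lerBrDr.
  rewrite !lebesgue_measure_itv /= !lte_fin ltrBlDr subrK.
  by case: ifP => // _; rewrite -!EFinB; congr EFin; ring.
rewrite [RHS](eq_measure_integral mu); last by move=> A mA _; rewrite -muE.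
rewrite ge0_integral_pushforward//.
Qed.

(** Same argument as for translations; a dilation by [a] divides lengths by [a]. *)
Lemma lebesgue_scale (R : realType) (a : R) (f : R -> \bar R) : 0 < a ->
  measurable_fun setT f -> (forall x, 0 <= f x)%E ->
  (\int[lebesgue_measure]_x f x =
   a%:E * \int[lebesgue_measure]_x f (a * x)%R)%E.
Proof.
move=> a0 mf f0.
pose phi : measurableTypeR R -> measurableTypeR R := fun x => a * x.
have mphi : measurable_fun setT phi by exact: measurable_funM.
pose nu : {measure set (measurableTypeR R) -> \bar R} :=
  measure_function_pushforward__canonical__measure_function_Measure
   (@lebesgue_measure R) mphi.
have a0' : 0 <= a by exact: ltW.
pose k : {nonneg R} := NngNum a0'.
have muE (A : set (measurableTypeR R)) :
    measurable A -> lebesgue_measure A = mscale k nu A.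
  apply: lebesgue_measure_unique => _ [[x y] _ <-] /=.
  rewrite /mscale /= /pushforward.
  rewrite (_ : _ @^-1` _ = `]x / a, y / a]%classic); last first.
    apply/seteqP; split=> z /=;
      by rewrite !in_itv/= /phi ltr_pdivrMr// ler_pdivlMr// ![_ * a]mulrC.
  rewrite !lebesgue_measure_itv /= !lte_fin ltr_pM2r ?invr_gt0//.
  case: ifP => // _; last by rewrite mule0.
  rewrite -!EFinB -EFinM; congr EFin; field.
  by rewrite gt_eqF.
rewrite [LHS](eq_measure_integral (mscale k nu)); last by move=> A mA _; exact: muE.
rewrite ge0_integral_mscale//= ge0_integral_pushforward//.
Qed.

Lemma lebesgue_ge0Zl (R : realType) (f : R -> R) (c : \bar R) :
  measurable_fun setT f -> (forall x, 0 <= f x) -> (0 <= c)%E ->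
  (\int[lebesgue_measure]_x (c * (f x)%:E) =
   c * \int[lebesgue_measure]_x (f x)%:E)%E.
Proof.
move=> mf f0 c0; apply: ge0_integralZl => //; first exact/measurable_EFinP.
by move=> x _; rewrite lee_fin.
Qed.

Lemma lebesgue_ge0Zr (R : realType) (f : R -> R) (c : \bar R) :
  measurable_fun setT f -> (forall x, 0 <= f x) -> (0 <= c)%E ->
  (\int[lebesgue_measure]_x ((f x)%:E * c) =
   (\int[lebesgue_measure]_x (f x)%:E) * c)%E.
Proof.
move=> mf f0 c0; apply: ge0_integralZr => //; first exact/measurable_EFinP.
by move=> x _; rewrite lee_fin.
Qed.

(** * Gamma and beta integrals *)

(** The power is cut off at [0] so that the Gamma and beta integrands are
    functions on the whole line: the convolution [pow_conv] is then an integral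
    over the line as well, and translations and dilations move no bounds. *)
Definition pospow (R : realType) (x s : R) : R :=
  if 0 < s then s `^ (x - 1) else 0.

Lemma pospow_ge0 (R : realType) (x s : R) : 0 <= pospow x s.
Proof. by rewrite /pospow; case: ifP => // _; exact: powR_ge0. Qed.

Lemma measurable_pospow (R : realType) (x : R) : measurable_fun setT (pospow x).
Proof.
apply: measurable_fun_ifT => //.
exact: measurable_fun_ltr.
Qed.

(** Euler's integral as an extended real, so that Tonelli applies before its
    finiteness is known; [egammaEFin] links it to [Gamma]. *)
Definition egamma (R : realType) (x : R) : \bar R :=
  (\int[lebesgue_measure]_s (pospow x s * expR (- s))%:E)%E.

(** At [u = 1] this is Euler's beta function. *)
Definition pow_conv (R : realType) (x y u : R) : \bar R :=
  (\int[lebesgue_measure]_s (pospow x s * pospow y (u - s))%:E)%E.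

Lemma measurable_gamma_integrand (R : realType) (x : R) :
  measurable_fun setT (fun s : R => pospow x s * expR (- s)).
Proof.
apply: measurable_funM; first exact: measurable_pospow.
by apply: measurableT_comp => //; exact: measurable_funN.
Qed.

Lemma pow_conv_ge0 (R : realType) (x y u : R) : (0 <= pow_conv x y u)%E.
Proof.
by apply: integral_ge0 => s _; rewrite lee_fin mulr_ge0 ?pospow_ge0.
Qed.

Lemma egamma_ge0 (R : realType) (x : R) : (0 <= egamma x)%E.
Proof.
by apply: integral_ge0 => s _; rewrite lee_fin mulr_ge0 ?pospow_ge0 ?expR_ge0.
Qed.

Lemma measurable_pow_conv_integrand (R : realType) (x y v : R) :
  measurable_fun setT (fun s : R => pospow x s * pospow y (v - s)).
Proof.
apply: measurable_funM; first exact: measurable_pospow.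
apply: measurableT_comp; first exact: measurable_pospow.
exact: measurable_funB.
Qed.

(** Homogeneity, by the dilation of ratio [u]. *)
Lemma pow_convE (R : realType) (x y u : R) :
  pow_conv x y u = ((pospow (x + y) u)%:E * pow_conv x y 1)%E.
Proof.
rewrite /pow_conv; have [u0|u0] := ltP 0 u; last first.
  have -> : pospow (x + y) u = 0 by rewrite /pospow ltNge u0.
  rewrite mul0e integral0_eq// => s _.
  rewrite /pospow; case: ltP => s0; last by rewrite mul0r.
  by rewrite subr_gt0 ltNge (ltW (le_lt_trans u0 s0)) mulr0.
have mf v := measurable_pow_conv_integrand x y v.
have f0 v (s : R) : 0 <= pospow x s * pospow y (v - s).
  by rewrite mulr_ge0 ?pospow_ge0.
rewrite [LHS](@lebesgue_scale _ u (fun s => (pospow x s * pospow y (u - s))%:E) u0);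
  [|exact/measurable_EFinP|by move=> s; rewrite lee_fin].
rewrite -[LHS]lebesgue_ge0Zl;
  [|by apply: (measurableT_comp (mf u)); exact: measurable_funM
   |by move=> s; exact: f0|by rewrite lee_fin ltW].
rewrite -[RHS]lebesgue_ge0Zl;
  [|exact: mf|exact: f0|by rewrite lee_fin pospow_ge0].
apply: eq_integral => s _; rewrite -!EFinM; congr EFin.
rewrite (_ : u - u * s = u * (1 - s)); last by ring.
rewrite /pospow u0 !pmulr_rgt0//.
case: ltP => s0; last by rewrite !(mul0r, mulr0).
rewrite subr_gt0; case: ltP => s1; last by rewrite !(mul0r, mulr0).
have s1' : 0 < 1 - s by rewrite subr_gt0.
rewrite !powRM; [|exact: ltW..].
rewrite (_ : x + y - 1 = 1 + (x - 1) + (y - 1)); last by ring.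
have un0 : u != 0 by rewrite gt_eqF.
have uD r t : u `^ (r + t) = u `^ r * u `^ t by rewrite powRD ?un0 ?implybT.
rewrite !uD.
by rewrite powRr1 ?(ltW u0)//; ring.
Qed.

(** The product is a double integral over [(s, v)]; substituting [v = u - s] and
    exchanging the integrals lets the exponential depend on [u] only, and what
    remains inside is the convolution of the two powers. *)
Lemma egammaM (R : realType) (x y : R) :
  (egamma x * egamma y = egamma (x + y) * pow_conv x y 1)%E.
Proof.
have mg (z : R) := measurable_gamma_integrand z.
have g0 z (s : R) : 0 <= pospow z s * expR (- s).
  by rewrite mulr_ge0 ?pospow_ge0 ?expR_ge0.
rewrite {1}/egamma -[LHS]lebesgue_ge0Zr; [|exact: mg|exact: g0|exact: egamma_ge0].
pose F (p : R * R) : \bar R :=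
  (pospow x p.1 * pospow y (p.2 - p.1) * expR (- p.2))%:E.
transitivity (\int[lebesgue_measure]_s \int[lebesgue_measure]_u F (s, u))%E.
  apply: eq_integral => s _; rewrite /egamma.
  rewrite -(@lebesgue_shift _ (- s) (fun t => (pospow y t * expR (- t))%:E));
    [|exact/measurable_EFinP|by move=> u; rewrite lee_fin].
  rewrite -[LHS]lebesgue_ge0Zl;
    [|by apply: (measurableT_comp (mg y)); exact: measurable_funB
     |by move=> t; exact: g0|by rewrite lee_fin].
  apply: eq_integral => u _; rewrite /F /= -EFinM; congr EFin.
  rewrite [in RHS](_ : - u = - s + - (u - s)); last by ring.
  by rewrite [in RHS]expRD; ring.
transitivity (\int[lebesgue_measure]_u \int[lebesgue_measure]_s F (s, u))%E.
  apply: (@fubini_tonelli _ _ (measurableTypeR R) (measurableTypeR R) R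
    (@lebesgue_measure R) (@lebesgue_measure R) F).
  - apply/measurable_EFinP; apply: measurable_funM.
      apply: measurable_funM.
        by apply: measurableT_comp; first exact: measurable_pospow.
      apply: measurableT_comp; first exact: measurable_pospow.
      exact: measurable_funB.
    by apply: measurableT_comp => //; exact: measurableT_comp.
  - by move=> p; rewrite lee_fin !mulr_ge0 ?pospow_ge0 ?expR_ge0.
rewrite [in RHS]/egamma -[RHS]lebesgue_ge0Zr;
  [|exact: mg|exact: g0|exact: pow_conv_ge0].
apply: eq_integral => u _.
transitivity (pow_conv x y u * (expR (- u))%:E)%E.
  rewrite /pow_conv -[RHS]lebesgue_ge0Zr;
    [by []|exact: measurable_pow_conv_integrand
    |by move=> s; rewrite mulr_ge0 ?pospow_ge0|by rewrite lee_fin expR_ge0].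
rewrite pow_convE EFinM -!muleA; congr (_ * _)%E; exact: muleC.
Qed.

Lemma egammaE (R : realType) (x : R) : egamma x =
  (\int[lebesgue_measure]_(t in `]0%R, +oo[) (t `^ (x - 1) * expR (- t))%:E)%E.
Proof.
rewrite /egamma [RHS]integral_mkcond; apply: eq_integral => s _.
rewrite patchE /pospow mem_setE in_itv /= andbT.
by case: ltP => // _; rewrite mul0r.
Qed.

Lemma egamma1 (R : realType) : egamma (1 : R) = 1%E.
Proof.
rewrite egammaE integral_itv_obnd_cbnd; last first.
  apply/measurable_EFinP/measurable_funTS; apply: measurable_funM => //.
  by apply: measurableT_comp => //; exact: measurable_funN.
rewrite -[RHS](@integral_exponential_pdf R 1)// integral_mkcond.
apply: eq_integral => s _; rewrite /exponential_pdf !patchE.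
case: ifP => // _; congr EFin.
by rewrite subrr powRr0 !mul1r mulN1r.
Qed.

Lemma integral_powR_itv (R : realType) (x c : R) : 0 < x -> 0 < c < 1 ->
  (\int[lebesgue_measure]_(t in `[c, 1%R]) (t `^ (x - 1))%:E =
   ((1 - c `^ x) / x)%:E)%E.
Proof.
move=> x0 /andP[c0 c1].
have dp (a t : R) : 0 < t -> is_derive t 1 (fun u => u `^ a) (a * t `^ (a - 1)).
  by move=> t0; exact: is_derive1_powR.
have cp (a t : R) : 0 < t -> {for t, continuous (fun u => u `^ a)}.
  move=> t0; have := dp a t t0 => -[d _].
  exact/differentiable_continuous/derivable1_diffP.
have dF (t : R) : 0 < t -> is_derive t 1 (fun u => x^-1 * u `^ x) (t `^ (x - 1)).
  move=> t0; have H := dp x t t0.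
  have -> : t `^ (x - 1) = x^-1 *: (x * t `^ (x - 1)).
    by rewrite /GRing.scale/= mulKf// gt_eqF.
  exact: is_deriveZ.
have cF (t : R) : 0 < t -> {for t, continuous (fun u => x^-1 * u `^ x)}.
  move=> t0; have := dF t t0 => -[d _].
  exact/differentiable_continuous/derivable1_diffP.
rewrite (@continuous_FTC2 _ _ (fun u => x^-1 * u `^ x) _ _ c1).
- by rewrite -EFinB powR1; congr EFin; ring.
- apply/continuous_within_itvP => //; split.
  + by move=> t; rewrite in_itv/= => /andP[ct _]; apply: cp; exact: lt_trans ct.
  + by apply: cvg_at_right_filter; apply: cp.
  + by apply: cvg_at_left_filter; apply: cp.
- split.
  + move=> t; rewrite in_itv/= => /andP[ct _].
    by have := dF t (lt_trans c0 ct) => -[].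
  + by apply: cvg_at_right_filter; apply: cF.
  + by apply: cvg_at_left_filter; apply: cF.
- move=> t; rewrite in_itv/= => /andP[ct _].
  by rewrite derive1E; have := dF t (lt_trans c0 ct) => -[].
Qed.

(** The integrand may be unbounded at [0]: the fundamental theorem of calculus
    is applied on [`[c, 1]] and [c] tends to [0] along [1 / (n + 2)], by monotone
    convergence. *)
Lemma integral_powR01 (R : realType) (x : R) : 0 < x ->
  (\int[lebesgue_measure]_(t in `]0%R, 1%R]) (t `^ (x - 1))%:E = (x^-1)%:E)%E.
Proof.
move=> x0.
pose c (n : nat) : R := n.+2%:R^-1.
have c0 n : 0 < c n by rewrite invr_gt0.
have c1 n : c n < 1 by rewrite invf_lt1// ltr1n.
pose F (n : nat) := `[c n, 1%R]%classic.
have cup : \bigcup_n F n = `]0%R, 1%R]%classic.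
  apply/seteqP; split=> t /=.
    by move=> [n _]; rewrite /F/= !in_itv/= => /andP[h ->]; rewrite (lt_le_trans _ h).
  rewrite in_itv /= => /andP[t0 t1].
  have [N _ h] := near_infty_natSinv_lt (PosNum t0).
  exists N => //=; rewrite /F/= in_itv /= t1 andbT.
  apply/ltW/(le_lt_trans _ (h N _)) => //=.
  by rewrite /c lef_pV2 ?posrE// ler_nat.
have h1 : (\int[lebesgue_measure]_(t in F n) (t `^ (x - 1))%:E @[n --> \oo] -->
   \int[lebesgue_measure]_(t in \bigcup_n F n) (t `^ (x - 1))%:E)%E.
  apply: ge0_nondecreasing_set_cvg_integral.
  - move=> m n mn; rewrite subsetEset => t; rewrite /F/= !in_itv /= => /andP[h ->].
    rewrite andbT (le_trans _ h)// /c lef_pV2 ?posrE//.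
    by rewrite ler_nat !ltnS.
  - by move=> i; exact: measurable_itv.
  - by move=> i; apply/measurable_EFinP/measurable_funTS.
  - by move=> i t _; rewrite lee_fin powR_ge0.
have c_cvg : c n @[n --> \oo] --> (0 : R).
  by rewrite (cvg_shiftS (@harmonic R)); exact: cvg_harmonic.
have hr : (1 - c n `^ x) / x @[n --> \oo] --> x^-1.
  rewrite -[X in _ --> X]mul1r -[in X in _ --> X](subr0 1).
  apply: cvgM; last exact: cvg_cst.
  apply: cvgB; first exact: cvg_cst.
  by have /cvg_at_rightP := @powR_cvg0 R x x0; apply; split.
have h2 : (\int[lebesgue_measure]_(t in F n) (t `^ (x - 1))%:E @[n --> \oo] -->
    (x^-1)%:E)%E.
  rewrite (_ : (fun n : nat => _) = EFin \o (fun n => (1 - c n `^ x) / x)).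
    by apply: cvg_EFin; [exact: nearW|exact: hr].
  by apply/funext => n; rewrite /F integral_powR_itv// c0 c1.
by rewrite -cup; exact: cvg_unique h1 h2.
Qed.

Lemma pow_conv1 (R : realType) (x : R) : 0 < x -> pow_conv x 1 1 = (x^-1)%:E.
Proof.
move=> x0; rewrite -integral_powR01// -integral_itv_bndo_bndc; last first.
  exact/measurable_EFinP/measurable_funTS.
rewrite [RHS]integral_mkcond; apply: eq_integral => s _.
rewrite patchE mem_setE in_itv /= /pospow subr_gt0.
case: (ltP 0 s) => s0 /=; last by rewrite mul0r.
by case: ltP => s1; rewrite ?mulr0// subrr powRr0 mulr1.
Qed.

(** The functional equation is the case [y = 1] of [egammaM]. *)
Lemma egammaS (R : realType) (x : R) : 0 < x ->
  egamma x = (egamma (x + 1) * (x^-1)%:E)%E.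
Proof. by move=> x0; rewrite -pow_conv1// -egammaM egamma1 mule1. Qed.

Lemma egamma_natS_fin (R : realType) (n : nat) : (egamma (n.+1%:R : R) < +oo)%E.
Proof.
elim: n => [|n ih]; first by rewrite egamma1 ltry.
move: ih; rewrite egammaS// natr1.
have := egamma_ge0 (n.+2%:R : R).
case: (egamma n.+2%:R) => [r| |]//; first by rewrite !ltry.
by rewrite gt0_mulye ?lte_fin ?invr_gt0.
Qed.

(** The integrand is at most [s `^ (x - 1)] on ]0, 1[, and beyond [1] at most
    the integrand for an integer above [x], where finiteness follows from the
    functional equation. *)
Lemma egamma_lty (R : realType) (x : R) : 0 < x -> (egamma x < +oo)%E.
Proof.
move=> x0; pose n := (Num.truncn x).
have xn : x <= n.+1%:R by rewrite ltW// truncnS_gt.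
pose f (s : R) := pospow x s * expR (- s).
pose g (s : R) := pospow x s * pospow 1 (1 - s) + pospow n.+1%:R s * expR (- s).
have f0 s : 0 <= f s by rewrite mulr_ge0 ?pospow_ge0 ?expR_ge0.
have fg s : f s <= g s.
  rewrite /f /g /pospow subr_gt0; case: (ltP 0 s) => s0; last by rewrite !mul0r addr0.
  case: ltP => s1.
    rewrite subrr powRr0 mulr1 ler_wpDr//.
      by rewrite mulr_ge0 ?powR_ge0 ?expR_ge0.
    by rewrite ler_piMr ?powR_ge0// -expR0 ler_expR oppr_le0 ltW.
  by rewrite mulr0 add0r ler_wpM2r ?expR_ge0// ler_powR// lerB.
have mg := measurable_gamma_integrand (n.+1%:R : R).
have mc := measurable_pow_conv_integrand x 1 1.
apply: (@le_lt_trans _ _ (pow_conv x 1 1 + egamma (n.+1%:R : R))%E).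
  rewrite -ge0_integralD//; last 4 first.
  - by move=> s _; rewrite lee_fin mulr_ge0 ?pospow_ge0.
  - exact/measurable_EFinP.
  - by move=> s _; rewrite lee_fin mulr_ge0 ?pospow_ge0 ?expR_ge0.
  - exact/measurable_EFinP.
  apply: ge0_le_integral => //.
  - by move=> s _; rewrite lee_fin; exact: f0.
  - by apply/measurable_EFinP; exact: measurable_gamma_integrand.
  - apply/emeasurable_funD; first exact/measurable_EFinP.
    exact/measurable_EFinP.
  - by move=> s _; rewrite -EFinD lee_fin; exact: fg.
by rewrite pow_conv1// lte_add_pinfty ?ltry// egamma_natS_fin.
Qed.

(** On ]c, +oo[ one has [s `^ x >= c `^ x], and the exponential integrates to
    [expR (- c)].  As [c] is arbitrary, Gamma grows faster than any geometric
    sequence. *)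
Lemma egamma_lower (R : realType) (x c : R) : 0 < c -> 0 <= x ->
  ((c `^ x * expR (- c))%:E <= egamma (x + 1))%E.
Proof.
move=> c0 x0.
have mg := measurable_gamma_integrand (x + 1).
pose h (s : R) : R := c `^ x * (pospow 1 (s - c) * expR (- s)).
have h0 s : 0 <= pospow 1 (s - c) * expR (- s).
  by rewrite mulr_ge0 ?pospow_ge0 ?expR_ge0.
have mh : measurable_fun setT (fun s : R => pospow 1 (s - c) * expR (- s)).
  apply: measurable_funM.
    by apply: measurableT_comp; [exact: measurable_pospow|exact: measurable_funB].
  by apply: measurableT_comp => //; exact: measurable_funN.
apply: (@le_trans _ _ (\int[lebesgue_measure]_s (h s)%:E)%E); last first.
  apply: ge0_le_integral => //.
  - by move=> s _; rewrite lee_fin /h mulr_ge0 ?powR_ge0.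
  - by apply/measurable_EFinP; exact: measurable_funM.
  - exact/measurable_EFinP.
  - move=> s _; rewrite lee_fin /h /pospow subr_gt0.
    case: ltP => cs; last first.
      rewrite mul0r mulr0; case: ifP => _;
        by rewrite ?mul0r ?mulr_ge0 ?powR_ge0 ?expR_ge0.
    rewrite (lt_trans c0 cs) subrr powRr0 mul1r addrK.
    apply: ler_wpM2r; first exact: expR_ge0.
    by apply: ge0_ler_powR; rewrite ?nnegrE// ltW// (lt_trans c0).
under eq_integral do rewrite EFinM.
rewrite lebesgue_ge0Zl//; last by rewrite lee_fin powR_ge0.
rewrite EFinM lee_wpmul2l ?lee_fin ?powR_ge0//.
rewrite -(@lebesgue_shift _ c (fun s => (pospow 1 (s - c) * expR (- s))%:E)); last 2 first.
- exact/measurable_EFinP.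
- by move=> s; rewrite lee_fin.
rewrite -[leLHS]mule1 -(egamma1 R) /egamma -lebesgue_ge0Zl; last 3 first.
- exact: measurable_gamma_integrand.
- by move=> s; rewrite mulr_ge0 ?pospow_ge0 ?expR_ge0.
- by rewrite lee_fin expR_ge0.
rewrite le_eqVlt; apply/orP; left; apply/eqP.
apply: eq_integral => s _; rewrite -EFinM addrK; congr EFin.
by rewrite opprD expRD; ring.
Qed.

Lemma egammaEFin (R : realType) (x : R) : 0 < x -> egamma x = (Gamma x)%:E.
Proof.
move=> x0; rewrite /Gamma /Rintegral -egammaE fineK// ge0_fin_numE ?egamma_lty//.
exact: egamma_ge0.
Qed.

Lemma Gamma_lower (R : realType) (x c : R) : 0 < c -> 0 <= x ->
  c `^ x * expR (- c) <= Gamma (x + 1).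
Proof.
move=> c0 x0; rewrite -lee_fin -egammaEFin ?egamma_lower//.
by rewrite ltr_wpDl.
Qed.

Lemma GammaS (R : realType) (x : R) : 0 < x -> Gamma (x + 1) = x * Gamma x.
Proof.
move=> x0; have := egammaS x0; rewrite !egammaEFin ?addr_gt0// -EFinM => -[->].
by rewrite mulrC divfK// gt_eqF.
Qed.

Lemma Gamma_gt0 (R : realType) (x : R) : 0 < x -> 0 < Gamma x.
Proof.
move=> x0; have : 0 < Gamma (x + 1).
  by rewrite (lt_le_trans _ (@Gamma_lower _ x 1 ltr01 (ltW x0)))// powR1 mul1r expR_gt0.
by rewrite GammaS// pmulr_rgt0.
Qed.

Lemma pow_conv_Gamma (R : realType) (x y u : R) : 0 < x -> 0 < y -> 0 < u ->
  pow_conv x y u = (u `^ (x + y - 1) * (Gamma x * Gamma y / Gamma (x + y)))%:E.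
Proof.
move=> x0 y0 u0; have xy0 : 0 < x + y by exact: addr_gt0.
rewrite pow_convE {1}/pospow u0 [RHS]EFinM; congr (_ * _)%E.
have := egammaM x y; rewrite !egammaEFin// -EFinM.
have := pow_conv_ge0 x y 1; case: (pow_conv x y 1) => [r| |] //.
  by move=> _; rewrite -EFinM => -[->]; rewrite mulrC mulKf// gt_eqF// Gamma_gt0.
by move=> _; rewrite gt0_muley ?lte_fin ?Gamma_gt0.
Qed.

(** * Power series *)

Lemma series_recl (V : zmodType) (u : V ^nat) (n : nat) :
  series u n.+1 = u 0%N + series (fun k => u k.+1) n.
Proof. by rewrite /series /= big_nat_recl. Qed.

Lemma is_cvg_series_behead (R : realType) (u : R ^nat) :
  cvgn (series u) -> cvgn (series (fun k => u k.+1)).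
Proof.
move=> /cvg_ex [l ul]; apply/cvg_ex; exists (l - u 0%N).
rewrite (_ : series _ = (fun n => series u n.+1 - u 0%N)); last first.
  by apply/funext => n; rewrite series_recl addrC addKr.
by apply: cvgB; [rewrite (cvg_shiftS (series u))|exact: cvg_cst].
Qed.

(** Comparison with a geometric series: [Gamma_lower] with [c] chosen such that
    [c `^ alpha = 2 * `|x| + 1] bounds the terms by powers of a ratio less
    than [1]. *)
Lemma mittag_leffler_is_cvg (R : realType) (alpha x : R) : 0 < alpha ->
  cvgn [normed series (fun n : nat => x ^+ n / Gamma (alpha * n%:R + 1))].
Proof.
move=> a0; pose d := 2 * `|x| + 1; pose c := d `^ alpha^-1.
have d0 : 0 < d by rewrite ltr_wpDl// mulr_ge0.
have c0 : 0 < c by exact: powR_gt0.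
have q1 : `| (`|x| / d) | < 1.
  rewrite ger0_norm ?divr_ge0 ?(ltW d0)// ltr_pdivrMr// mul1r /d.
  by have := normr_ge0 x; lra.
apply: (@series_le_cvg _ _ (geometric (expR c) (`|x| / d))).
- by move=> n; exact: normr_ge0.
- move=> n /=; by rewrite mulr_ge0 ?expR_ge0// exprn_ge0// divr_ge0// ltW.
- move=> n; have G0 : 0 < Gamma (alpha * n%:R + 1).
    by apply: Gamma_gt0; rewrite ltr_wpDl// mulr_ge0// ltW.
  rewrite /= normrM normrX normfV (gtr0_norm G0) ler_pdivrMr// expr_div_n.
  have := @Gamma_lower R (alpha * n%:R) c c0; rewrite mulr_ge0 ?(ltW a0)// => /(_ isT).
  have -> : c `^ (alpha * n%:R) = d ^+ n.
    by rewrite /c -powRrM mulrA mulVf ?gt_eqF// mul1r powR_mulrn// ltW.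
  rewrite expRN ler_pdivrMr ?expR_gt0// => h.
  have -> : expR c * (`|x| ^+ n / d ^+ n) * Gamma (alpha * n%:R + 1) =
      `|x| ^+ n * (Gamma (alpha * n%:R + 1) * expR c / d ^+ n) by ring.
  by rewrite ler_peMr ?exprn_ge0// ler_pdivlMr ?exprn_gt0// mul1r.
- exact: is_cvg_geometric_series.
Qed.

(** A bound on [n.+1 * q ^+ n] that is uniform in [n]: it absorbs the factor
    [n.+1] that differentiation creates, at the price of a slightly smaller
    radius. *)
Lemma ler_natS_exprn (R : realFieldType) (q : R) (n : nat) : 0 <= q <= 1 ->
  n.+1%:R * ((1 - q) * q ^+ n) <= 1 - q ^+ n.+1.
Proof.
move=> /andP[q0 q1]; elim: n => [|n ih]; first by rewrite !expr0 expr1; lra.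
have h0 : 0 <= q ^+ n.+1 by exact: exprn_ge0.
have h1 : q ^+ n.+1 <= 1 by exact: exprn_ile1.
rewrite -natr1 mulrDl mul1r.
have h2 : (1 - q) * q ^+ n.+1 <= 1 - q by rewrite ler_piMr// subr_ge0.
have h3 := ler_wpM2l q0 ih.
have e1 : n.+1%:R * ((1 - q) * q ^+ n.+1) = q * (n.+1%:R * ((1 - q) * q ^+ n)).
  by rewrite exprS; ring.
rewrite e1 (exprS q n.+1).
nra.
Qed.

Lemma is_cvg_pseries_diffs (R : realType) (c : R ^nat) (r x : R) :
  cvgn (pseries c r) -> `|x| < `|r| ->
  cvgn (pseries (pseries_diffs c) x).
Proof.
move=> cr xr; pose rho := (`|x| + `|r|) / 2.
have r0 : 0 < rho by rewrite /rho; have := normr_ge0 x; lra.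
have xrho : `|x| < rho by rewrite /rho; lra.
have rhor : `|rho| < `|r| by rewrite gtr0_norm// /rho; lra.
apply: normed_cvg.
have := is_cvg_series_behead (is_cvg_pseries_inside_norm cr rhor).
pose q := `|x| / rho.
have q0 : 0 <= q by rewrite divr_ge0// ltW.
have q1 : q < 1 by rewrite ltr_pdivrMr// mul1r.
move=> /(is_cvg_seriesZ (k := (rho * (1 - q))^-1)); apply: series_le_cvg => n.
- exact: normr_ge0.
- change (0 <= (rho * (1 - q))^-1 * (`|c n.+1| * rho ^+ n.+1)).
  by rewrite !mulr_ge0 ?exprn_ge0 ?invr_ge0 ?mulr_ge0 ?subr_ge0// ltW.
- change (`|pseries_diffs c n * x ^+ n| <= (rho * (1 - q))^-1 * (`|c n.+1| * rho ^+ n.+1)).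
  rewrite /pseries_diffs !normrM normrX ger0_norm//.
  have := @ler_natS_exprn R q n; rewrite q0 (ltW q1) => /(_ isT) h.
  have -> : `|x| = q * rho by rewrite divfK// gt_eqF.
  rewrite exprMn exprS.
  have h1 : n.+1%:R * ((1 - q) * q ^+ n) <= 1.
    by rewrite (le_trans h)// lerBlDr lerDl exprn_ge0.
  clearbody rho q.
  have -> : (rho * (1 - q))^-1 * (`|c n.+1| * (rho * rho ^+ n)) =
      `|c n.+1| * rho ^+ n / (1 - q).
    by field; rewrite (gt_eqF r0) subr_eq0 eq_sym lt_eqF.
  have q1' : 0 < 1 - q by rewrite subr_gt0.
  rewrite ler_pdivlMr//.
  have -> : n.+1%:R * `|c n.+1| * (q ^+ n * rho ^+ n) * (1 - q) =
     (n.+1%:R * ((1 - q) * q ^+ n)) * (`|c n.+1| * rho ^+ n) by ring.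
  by rewrite ler_piMl// mulr_ge0// exprn_ge0// ltW.
Qed.

(** The criterion [pseries_snd_diffs] asks for the convergence of the series and
    of its first two derived series at one point [a] outside [`|x|]; the
    second derived series converges there because the first one converges at
    [b], between [a] and [`|r|]. *)
Lemma is_derive_pseries (R : realType) (c : R ^nat) (r x : R) :
  cvgn (pseries c r) -> `|x| < `|r| ->
  is_derive x 1 (fun y => limn (pseries c y)) (limn (pseries (pseries_diffs c) x)).
Proof.
move=> cr xr.
pose a := (`|x| + `|r|) / 2; pose b := (a + `|r|) / 2.
have n0 := normr_ge0 x.
have a0 : `|a| = a by rewrite ger0_norm// /a; lra.
have b0 : `|b| = b by rewrite ger0_norm// /b /a; lra.
apply: (@pseries_snd_diffs _ c a).
- by apply: is_cvg_pseries_inside cr _; rewrite a0 /a; lra.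
- by apply: is_cvg_pseries_diffs cr _; rewrite a0 /a; lra.
- apply: (@is_cvg_pseries_diffs _ _ b); last by rewrite a0 b0 /b /a; lra.
  by apply: is_cvg_pseries_diffs cr _; rewrite b0 /b /a; lra.
- by rewrite a0 /a; lra.
Qed.

(** Both sides sum [F k l] over the triangle [k + l < n], by diagonals and by
    rows. *)
Lemma triangular_sum (V : nmodType) (F : nat -> nat -> V) (n : nat) :
  \sum_(0 <= m < n) \sum_(0 <= k < m.+1) F k (m - k)%N =
  \sum_(0 <= k < n) \sum_(0 <= l < n - k) F k l.
Proof.
elim: n => [|n ih]; first by rewrite !big_geq.
rewrite big_nat_recr//= ih [RHS]big_nat_recr//= subSn// subnn big_nat1.
rewrite [X in _ + X]big_nat_recr//= subnn addrA; congr (_ + _).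
rewrite -big_split/=; apply: eq_big_nat => k /andP[_ kn].
by rewrite subSn ?(ltnW kn)// [RHS]big_nat_recr.
Qed.

Definition cauchy_prod (R : pzSemiRingType) (u v : R ^nat) : R ^nat :=
  fun m => \sum_(0 <= k < m.+1) u k * v (m - k)%N.

Lemma series_cauchy_prod (R : pzSemiRingType) (u v : R ^nat) (n : nat) :
  \sum_(0 <= m < n) cauchy_prod u v m =
  \sum_(0 <= k < n) u k * \sum_(0 <= l < n - k) v l.
Proof.
rewrite /cauchy_prod (triangular_sum (fun k l => u k * v l)).
by apply: eq_bigr => k _; rewrite mulr_sumr.
Qed.

(** Write [U, V, W] for the partial sums of [u], [v] and their Cauchy product,
    and [U', V', W'] for those of the sequences of absolute values.  The
    difference [U n * V n - W n] is the sum of [u k * v l] over [k, l < n] with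
    [k + l >= n], so it is bounded by [U' n * V' n - W' n].  The latter tends to
    [0], because [W'] is squeezed: [U' n * V' n <= W' (n + n)] and
    [W' n <= limn U' * limn V']. *)
Section cauchy_product.
Variables (R : realType) (u v : R ^nat).
Hypotheses (cu : cvgn [normed series u]) (cv : cvgn [normed series v]).

Let U' : R ^nat := series (fun n => `|u n|).
Let V' : R ^nat := series (fun n => `|v n|).
Let W' : R ^nat := series (cauchy_prod (fun n => `|u n|) (fun n => `|v n|)).

Let ndseries (w : R ^nat) : (forall n, 0 <= w n) -> nondecreasing_seq (series w).
Proof. by move=> w0; apply: nondecreasing_series => n _ _. Qed.

Let ndU : nondecreasing_seq U'. Proof. exact: ndseries. Qed.
Let ndV : nondecreasing_seq V'. Proof. exact: ndseries. Qed.
Let ndW : nondecreasing_seq W'.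
Proof. by apply: ndseries => n; apply: sumr_ge0 => k _; rewrite mulr_ge0. Qed.

Let leU n : U' n <= limn U'. Proof. exact: nondecreasing_cvgn_le. Qed.
Let leV n : V' n <= limn V'. Proof. exact: nondecreasing_cvgn_le. Qed.
Let V0 n : 0 <= V' n. Proof. exact: sumr_ge0. Qed.

Let leW n : W' n <= limn U' * limn V'.
Proof.
rewrite /W' /series /= series_cauchy_prod.
apply: (@le_trans _ _ (U' n * limn V')); last by rewrite ler_wpM2r// (le_trans (V0 0)).
rewrite /U' /series /= mulr_suml; apply: ler_sum => k _.
by apply: ler_wpM2l => //; exact: leV.
Qed.

(** This bound, uniform in [n], is the domination used under the integral. *)
Lemma le_cauchy_prod n :
  `|series (cauchy_prod u v) n| <= limn [normed series u] * limn [normed series v].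
Proof.
apply: le_trans (leW n); rewrite /series /=.
apply: (le_trans (ler_norm_sum _ _ _)); apply: ler_sum => m _.
apply: (le_trans (ler_norm_sum _ _ _)); apply: ler_sum => k _.
by rewrite normrM.
Qed.

Let UVleW n : U' n * V' n <= W' (n + n)%N.
Proof.
rewrite /W' /series /= series_cauchy_prod (big_cat_nat (n := n)) ?leq_addr//=.
rewrite /U' /series /= mulr_suml ler_wpDr//.
  by apply: sumr_ge0 => k _; rewrite mulr_ge0// sumr_ge0.
apply: ler_sum_nat => k /andP[_ kn]; apply: ler_wpM2l => //.
by apply: ndV; rewrite -addnBA ?leq_addr// ltnW.
Qed.

Let cvgW : W' @ \oo --> limn U' * limn V'.
Proof.
have cW : cvgn W'.
  by apply: nondecreasing_is_cvgn => //; exists (limn U' * limn V') => _ [n _ <-].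
suff -> : limn U' * limn V' = limn W' by [].
apply/eqP; rewrite eq_le; apply/andP; split; last first.
  by apply: limr_le => //; exact: nearW.
rewrite -limM//; apply: limr_le; first exact: is_cvgM.
apply: nearW => n; rewrite (le_trans (UVleW n))//.
exact: nondecreasing_cvgn_le.
Qed.

Lemma cvg_cauchy_prod :
  series (cauchy_prod u v) @ \oo --> limn (series u) * limn (series v).
Proof.
have cu1 : cvgn (series u) by exact: normed_cvg.
have cv1 : cvgn (series v) by exact: normed_cvg.
have UV : series u n * series v n @[n --> \oo] --> limn (series u) * limn (series v).
  exact: cvgM.
have D0 : U' n * V' n - W' n @[n --> \oo] --> (0 : R).
  rewrite -(subrr (limn U' * limn V')); apply: cvgB => //.
  exact: cvgM.
have D : series u n * series v n - series (cauchy_prod u v) n @[n --> \oo] --> (0 : R).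
  apply/norm_cvg0P; apply: (squeeze_cvgr _ (cvg_cst 0) D0).
  apply: nearW => n; rewrite normr_ge0 /=.
  rewrite /W' /U' /V' /series /= !series_cauchy_prod !mulr_suml -!sumrB.
  apply: (le_trans (ler_norm_sum _ _ _)); apply: ler_sum => k _.
  rewrite -!mulrBr normrM ler_wpM2l//.
  rewrite (big_cat_nat (n := (n - k)%N) (p := n)) ?leq_subr//=.
  rewrite [X in _ <= X - _](big_cat_nat (n := (n - k)%N) (p := n)) ?leq_subr//=.
  by rewrite [X in `|X|]addrC addKr [leRHS]addrC addKr; exact: ler_norm_sum.
rewrite -[X in _ --> X]subr0.
rewrite (_ : series (cauchy_prod u v) = (fun n => series u n * series v n -
   (series u n * series v n - series (cauchy_prod u v) n))); last first.
  by apply/funext => n; rewrite subKr.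
exact: cvgB.
Qed.

End cauchy_product.

(** The sum is continuous at [0], where its value is [c 0], and it vanishes on
    the right of [0]. *)
Lemma pseries_eq0_coef0 (R : realType) (c : R ^nat) (S : R) : 0 < S ->
  (forall s, 0 < s < S -> pseries c s @ \oo --> (0 : R)) -> c 0%N = 0.
Proof.
move=> S0 cs; pose r := S / 2; have r0 : 0 < r by rewrite divr_gt0.
have rS : r < S by rewrite /r; lra.
have h0 : limn (pseries c 0) = c 0%N.
  apply/cvg_lim => //; rewrite -cvg_shiftS /=.
  rewrite (_ : (fun n => _) = cst (c 0%N)); first exact: cvg_cst.
  apply/funext => n; rewrite /pseries series_recl /= expr0 mulr1 /series /=.
  by rewrite big1 ?addr0// => k _; rewrite expr0n/= mulr0.
have cr : cvgn (pseries c r) by apply/cvg_ex; exists 0; apply: cs; rewrite r0.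
have lt0r : `|0 : R| < `|r| by rewrite normr0 normr_gt0 gt_eqF.
have [/derivable1_diffP/differentiable_continuous d _] := is_derive_pseries cr lt0r.
have /cvg_at_rightP := cvg_at_right_filter d.
rewrite h0 => /(_ (fun n => r * harmonic n)) h.
have h1 : limn (pseries c (r * harmonic n)) @[n --> \oo] --> c 0%N.
  apply: h; split=> [n|]; first by rewrite mulr_gt0 ?harmonic_gt0.
  rewrite -[X in _ --> X](mulr0 r); apply: cvgM; first exact: cvg_cst.
  exact: cvg_harmonic.
apply: (cvg_unique _ h1) => //.
rewrite (_ : (fun n => _) = cst 0); first exact: cvg_cst.
apply/funext => n; apply/cvg_lim => //; apply: cs; rewrite mulr_gt0 ?harmonic_gt0//=.
rewrite (le_lt_trans _ rS)// ler_piMr ?(ltW r0)//.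
by rewrite invf_le1// ler1n.
Qed.

Lemma pseries_eq0_coef (R : realType) (c : R ^nat) (S : R) : 0 < S ->
  (forall s, 0 < s < S -> pseries c s @ \oo --> (0 : R)) -> forall n, c n = 0.
Proof.
move=> S0 cs n; elim: n c cs => [|n ih] c cs; first exact: pseries_eq0_coef0 cs.
have c0 := pseries_eq0_coef0 S0 cs.
apply: (ih (fun k => c k.+1)) => s sS; have /andP[s0 _] := sS.
rewrite (_ : pseries _ s = (fun n => s^-1 * pseries c s n.+1)); last first.
  apply/funext => k; rewrite /pseries series_recl /= c0 mul0r add0r /series /=.
  rewrite mulr_sumr; apply: eq_bigr => j _.
  by rewrite exprS; field; rewrite gt_eqF.
rewrite -(mulr0 s^-1); apply: cvgM; first exact: cvg_cst.
by rewrite (cvg_shiftS (pseries c s)); exact: cs.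
Qed.

(** * Series in powers of [t `^ alpha] *)

Lemma integral_beta (R : realType) (p q t : R) : 0 < p -> 0 < q -> 0 < t ->
  (\int[lebesgue_measure]_(x in `]0%R, t[) (x `^ (p - 1) * (t - x) `^ (q - 1))%:E =
   (t `^ (p + q - 1) * (Gamma p * Gamma q / Gamma (p + q)))%:E)%E.
Proof.
move=> p0 q0 t0; rewrite -pow_conv_Gamma// integral_mkcond.
apply: eq_integral => s _.
rewrite patchE mem_setE in_itv /= /pospow subr_gt0.
case: (ltP 0 s) => s0 /=; last by rewrite mul0r.
by case: ltP => // _; rewrite mulr0.
Qed.

Lemma measurable_beta_integrand (R : realType) (p q t : R) (D : set R) :
  measurable_fun D (fun x => x `^ p * (t - x) `^ q).
Proof.
apply: measurable_funTS; apply: measurable_funM => //.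
by apply: (measurableT_comp (measurable_powR q)); exact: measurable_funB.
Qed.

Lemma integrable_beta (R : realType) (p q t : R) : 0 < p -> 0 < q -> 0 < t ->
  (@lebesgue_measure R).-integrable `]0%R, t[
    (fun x => (x `^ (p - 1) * (t - x) `^ (q - 1))%:E).
Proof.
move=> p0 q0 t0; apply/integrableP; split.
  by apply/measurable_EFinP; exact: measurable_beta_integrand.
under eq_integral => x _ do rewrite gee0_abs ?lee_fin ?mulr_ge0 ?powR_ge0//.
by rewrite integral_beta// ltry.
Qed.

Lemma normed_series_le_lim (R : realType) (u : R ^nat) (n : nat) :
  cvgn [normed series u] -> [normed series u] n <= limn [normed series u].
Proof.
move=> cu; apply: nondecreasing_cvgn_le => //.
by apply: nondecreasing_series => k _ _; exact: normr_ge0.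
Qed.

Section fractional_series.
Variables (R : realType) (alpha : R).
Hypothesis a0 : 0 < alpha.

Lemma powR_natM (t : R) (k : nat) : t `^ (k%:R * alpha) = (t `^ alpha) ^+ k.
Proof. by rewrite mulrC powRrM powR_mulrn// powR_ge0. Qed.

Variables (c : R ^nat) (T : R) (f : R -> R).
Hypothesis cf : forall t, 0 <= t < T ->
  series (fun k : nat => c k * t `^ (k%:R * alpha)) @ \oo --> f t.

Let pf (t : R) : 0 <= t < T -> pseries c (t `^ alpha) @ \oo --> f t.
Proof.
move=> /cf; rewrite /pseries (_ : (fun k : nat => _) = (fun k => c k * (t `^ alpha) ^+ k))//.
by apply/funext => k; rewrite powR_natM.
Qed.

Let radius (t : R) : 0 <= t < T ->
  exists2 r, cvgn (pseries c r) & `|t `^ alpha| < `|r|.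
Proof.
move=> /andP[t0 tT]; exists (((t + T) / 2) `^ alpha).
  by apply/cvg_ex; exists (f ((t + T) / 2)); apply: pf; apply/andP; split; lra.
rewrite !ger0_norm ?powR_ge0//; apply: gt0_ltr_powR; rewrite ?nnegrE//; lra.
Qed.

Lemma normed_cvg_frac_series (t : R) : 0 <= t < T ->
  cvgn [normed series (fun k => c k * t `^ (k%:R * alpha))].
Proof.
move=> tT; have [r cr tr] := radius tT.
have := is_cvg_pseries_inside_norm cr (z := `|t `^ alpha|).
rewrite normr_id => /(_ tr); rewrite /pseries.
rewrite (_ : (fun i : nat => _) = (fun n => `|c n * t `^ (n%:R * alpha)|))//.
by apply/funext => k; rewrite powR_natM [RHS]normrM [X in _ = _ * X]normrX.
Qed.

(** The [k]-th term of the derived series; the constant term of the original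
    series contributes nothing, hence the shift to [k.+1]. *)
Definition frac_deriv_term (k : nat) (x : R) : R :=
  c k.+1 * (k.+1%:R * alpha) * x `^ (k.+1%:R * alpha - 1).

Let u := frac_deriv_term.

(** Factoring out [x `^ (alpha - 1)] isolates the singularity at [0] of the
    derivative; what remains is a power series in [x `^ alpha]. *)
Lemma frac_deriv_termE (k : nat) (x : R) : 0 < x ->
  u k x = alpha * x `^ (alpha - 1) * (pseries_diffs c k * (x `^ alpha) ^+ k).
Proof.
move=> x0; rewrite /u /frac_deriv_term /pseries_diffs -powR_natM.
have -> : k.+1%:R * alpha - 1 = (alpha - 1) + k%:R * alpha by rewrite -natr1; ring.
by rewrite powRD ?(gt_eqF x0) ?implybT//; ring.
Qed.

(** Convergence of the series at a point beyond [t] puts [t `^ alpha] inside the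
    disc of convergence. *)
Lemma is_derive_frac_series (t : R) : 0 < t < T ->
  is_derive t 1 f (limn (pseries (pseries_diffs c) (t `^ alpha)) * (alpha * t `^ (alpha - 1))).
Proof.
move=> /andP[t0 tT]; have tT' : 0 <= t < T by rewrite ltW.
have [r cr tr] := radius tT'.
have d1 := is_derive_pseries cr tr.
have d2 := is_derive1_powR alpha t0.
have d3 := is_derive1_comp (g := fun y : R => y `^ alpha) d1 d2.
apply: near_eq_is_derive d3; near=> x => /=.
apply/cvg_lim => //; apply: pf.
apply/andP; split; last by near: x; apply: lt_nbhsl.
by apply: ltW; near: x; apply: lt_nbhsr.
Unshelve. all: by end_near. Qed.

Definition frac_deriv_bound (t : R) : R :=
  alpha * limn [normed series (fun k => pseries_diffs c k * (t `^ alpha) ^+ k)].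

Lemma normed_cvg_frac_deriv (t : R) : 0 <= t < T ->
  cvgn [normed series (fun k => pseries_diffs c k * (t `^ alpha) ^+ k)].
Proof.
move=> tT; have [r cr tr] := radius tT.
pose m := (`|t `^ alpha| + `|r|) / 2.
have n0 := normr_ge0 (t `^ alpha).
have m0 : `|m| = m by rewrite ger0_norm// /m; lra.
have cm : cvgn (pseries (pseries_diffs c) m).
  by apply: is_cvg_pseries_diffs cr _; rewrite m0 /m; lra.
have := is_cvg_pseries_inside_norm cm (z := `|t `^ alpha|).
rewrite normr_id m0 => /(_ _); rewrite /pseries.
rewrite (_ : (fun i : nat => _) = (fun n => `|pseries_diffs c n * (t `^ alpha) ^+ n|)).
  by apply; rewrite /m; lra.
by apply/funext => k; rewrite [RHS]normrM [X in _ = _ * X]normrX.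
Qed.

Lemma normed_cvg_frac_deriv_term (x : R) : 0 < x < T -> cvgn [normed series (u ^~ x)].
Proof.
move=> /andP[x0 xT].
have h : cvgn [normed series (fun k => pseries_diffs c k * (x `^ alpha) ^+ k)].
  by apply: normed_cvg_frac_deriv; rewrite ltW.
have := is_cvg_seriesZ (k := alpha * x `^ (alpha - 1)) h.
set w := (X in cvgn (series X)); suff -> : w = [sequence `|u n x|]_n by [].
apply/funext => k.
change (alpha * x `^ (alpha - 1) * `|pseries_diffs c k * x `^ alpha ^+ k| = `|u k x|).
by rewrite frac_deriv_termE// [RHS]normrM ger0_norm// mulr_ge0 ?powR_ge0 ?ltW.
Qed.

Lemma derive_frac_series (t : R) : 0 < t < T ->
  series (u ^~ t) @ \oo --> derive1 f t.
Proof.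
move=> tT; have /andP[t0 t1] := tT.
have := is_derive_frac_series tT; rewrite derive1E => -[_ ->].
have h : cvgn (pseries (pseries_diffs c) (t `^ alpha)).
  by apply: normed_cvg; apply: normed_cvg_frac_deriv; rewrite ltW.
rewrite (_ : series _ = (fun n =>
    pseries (pseries_diffs c) (t `^ alpha) n * (alpha * t `^ (alpha - 1)))).
  by apply: cvgM => //; exact: cvg_cst.
apply/funext => n; rewrite /pseries /series /= mulr_suml; apply: eq_bigr => k _.
by rewrite frac_deriv_termE// mulrC.
Qed.

(** The bound is uniform on ]0, t] up to the integrable factor
    [x `^ (alpha - 1)]. *)
Lemma le_frac_deriv_term (t x : R) : 0 < x <= t -> t < T ->
  limn [normed series (u ^~ x)] <= frac_deriv_bound t * x `^ (alpha - 1).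
Proof.
move=> /andP[x0 xt] tT.
have t0 : 0 < t by exact: lt_le_trans xt.
have h : cvgn [normed series (fun k => pseries_diffs c k * (t `^ alpha) ^+ k)].
  by apply: normed_cvg_frac_deriv; rewrite ltW.
apply: limr_le; first by apply: normed_cvg_frac_deriv_term; rewrite x0 (le_lt_trans xt).
apply: nearW => n.
have h2 : [normed series (fun k => pseries_diffs c k * (t `^ alpha) ^+ k)] n <=
    limn [normed series (fun k => pseries_diffs c k * (t `^ alpha) ^+ k)].
  exact: normed_series_le_lim.
rewrite /frac_deriv_bound mulrAC mulrC; apply: (le_trans _ (ler_wpM2r _ h2)); last first.
  by rewrite mulr_ge0 ?powR_ge0// ltW.
rewrite /series /= mulr_suml; apply: ler_sum => k _.
rewrite frac_deriv_termE// mulrC normrM [X in _ * X <= _]ger0_norm; last first.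
  by rewrite mulr_ge0 ?powR_ge0// ltW.
apply: ler_wpM2r; first by rewrite mulr_ge0 ?powR_ge0// ltW.
rewrite [leLHS]normrM [leRHS]normrM; apply: ler_wpM2l => //.
rewrite !normrX !ger0_norm ?powR_ge0//.
apply: lerXn2r; rewrite ?nnegrE ?powR_ge0//.
by apply: ge0_ler_powR; rewrite ?nnegrE// ltW.
Qed.
End fractional_series.

(** * Convolution with the Mittag-Leffler kernel *)

Definition mittag_leffler_term (R : realType) (alpha x : R) (n : nat) : R :=
  x ^+ n / Gamma (alpha * n%:R + 1).

Lemma le_mittag_leffler_term (R : realType) (alpha l y t : R) : 0 < alpha -> 0 <= y <= t ->
  limn [normed series (mittag_leffler_term alpha (l * y `^ alpha))] <=
  limn [normed series (mittag_leffler_term alpha (l * t `^ alpha))].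
Proof.
move=> a0 /andP[y0 yt].
apply: limr_le; first exact: mittag_leffler_is_cvg.
apply: nearW => n; apply: le_trans (normed_series_le_lim n _); last exact: mittag_leffler_is_cvg.
apply: ler_sum => k _; rewrite /mittag_leffler_term.
rewrite [leLHS]normrM [leRHS]normrM; apply: ler_wpM2r => //.
rewrite !normrX; apply: lerXn2r; rewrite ?nnegrE//.
rewrite !normrM; apply: ler_wpM2l => //; rewrite !ger0_norm ?powR_ge0//.
by apply: ge0_ler_powR; rewrite ?nnegrE//; [exact: ltW|exact: le_trans yt].
Qed.

Lemma integrable_itv_oo_cc (R : realType) (g : R -> R) (a b : R) :
  (@lebesgue_measure R).-integrable `]a, b[ (EFin \o g) ->
  (@lebesgue_measure R).-integrable `[a, b] (EFin \o g).
Proof.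
move=> ig; have /integrableP[mg fg] := ig.
have mg' : measurable_fun `]a, b[ g by exact/measurable_EFinP.
apply/integrableP; split.
  by apply/emeasurable_fun_itv_bndo_bndcP/emeasurable_fun_itv_obnd_cbndP.
by rewrite (integral_itv_bndoo true false)//; exact: measurableT_comp.
Qed.

(** The [m]-th coefficient of the convolution of [f'] with the kernel
    [mittag_leffler alpha (l * y `^ alpha)], when [c] are the coefficients of
    [f]. *)
Definition convolution_coef (R : realType) (alpha l : R) (c : R ^nat) (m : nat) : R :=
  \sum_(1 <= k < m.+1) c k *
    (l ^+ (m - k) * (Gamma (k%:R * alpha + 1) / Gamma (m%:R * alpha + 1))).

Lemma normed_series_lim_ge0 (R : realType) (w : R ^nat) :
  cvgn [normed series w] -> 0 <= limn [normed series w].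
Proof.
move=> cw; apply: limr_ge => //; apply: nearW => n.
by apply: sumr_ge0 => k _; exact: normr_ge0.
Qed.

Lemma convolution_coef0 (R : realType) (alpha l : R) (c : R ^nat) :
  convolution_coef alpha l c 0 = 0.
Proof. by rewrite /convolution_coef big_geq. Qed.

Section convolution.
Variables (R : realType) (alpha l : R).
Hypothesis a0 : 0 < alpha.
Variables (c : R ^nat) (T : R) (f : R -> R).
Hypothesis cf : forall t, 0 <= t < T ->
  series (fun k : nat => c k * t `^ (k%:R * alpha)) @ \oo --> f t.
Variable (t : R).
Hypotheses (t0 : 0 < t) (tT : t < T).

Let mu := @lebesgue_measure R.
Let D : set (measurableTypeR R) := `]0%R, t[%classic.
Let mD : measurable D. Proof. exact: measurable_itv. Qed.
Let inD (x : R) : D x -> 0 < x < t. Proof. by rewrite /D /= in_itv. Qed.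

Let u (x : R) (k : nat) : R := frac_deriv_term alpha c k x.
Let v (x : R) (n : nat) : R := mittag_leffler_term alpha (l * (t - x) `^ alpha) n.

(* The integral over ]0, t[ of the product of the [k]-th term of [f'] and the
   [n]-th term of the kernel; [A] below collects the constants of that product. *)
Let K (k n : nat) : R := c k.+1 * (l ^+ n *
  (Gamma (k.+1%:R * alpha + 1) / Gamma ((k + n).+1%:R * alpha + 1))) *
  t `^ ((k + n).+1%:R * alpha).

Let A (k n : nat) : R := c k.+1 * (k.+1%:R * alpha) * (l ^+ n / Gamma (alpha * n%:R + 1)).

Let uvE k n x : u x k * v x n =
  A k n * (x `^ (k.+1%:R * alpha - 1) * (t - x) `^ (n%:R * alpha + 1 - 1)).
Proof.
rewrite /u /v /frac_deriv_term /mittag_leffler_term addrK powR_natM exprMn /A; ring.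
Qed.

Let ka0 (k : nat) : 0 < k.+1%:R * alpha. Proof. by rewrite mulr_gt0. Qed.
Let na0 (n : nat) : 0 < n%:R * alpha + 1.
Proof. by rewrite ltr_wpDl// mulr_ge0// ltW. Qed.

Let integrable_uv k n : mu.-integrable D (fun x => (u x k * v x n)%:E).
Proof.
have := integrableZl mD (A k n) (integrable_beta (ka0 k) (na0 n) t0).
by apply: eq_integrable => // x _; rewrite uvE EFinM.
Qed.

Let integral_uv k n : (\int[mu]_(x in D) (u x k * v x n)%:E = (K k n)%:E)%E.
Proof.
under eq_integral do rewrite uvE EFinM.
rewrite integralZl//; last exact: integrable_beta.
rewrite integral_beta// -EFinM; congr EFin.
have e1 : k.+1%:R * alpha + (n%:R * alpha + 1) = (k + n).+1%:R * alpha + 1.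
  by rewrite -addSn natrD; ring.
rewrite e1 addrK /A /K (GammaS (ka0 k)) [alpha * n%:R]mulrC.
have G1 : Gamma (n%:R * alpha + 1) != 0 by rewrite gt_eqF// Gamma_gt0.
have G2 : Gamma ((k + n).+1%:R * alpha + 1) != 0 by rewrite gt_eqF// Gamma_gt0.
move: (Gamma (n%:R * alpha + 1)) (Gamma ((k + n).+1%:R * alpha + 1)) G1 G2.
move: (Gamma (k.+1%:R * alpha)) (k.+1%:R * alpha) (t `^ _) => g p X g1 g2 G1 G2.
by field; rewrite G1 G2.
Qed.

Let S (N : nat) (x : R) : R := series (cauchy_prod (u x) (v x)) N.

Let SE N x : (S N x)%:E =
  (\sum_(0 <= m < N) \sum_(0 <= k < m.+1) (u x k * v x (m - k)%N)%:E)%E.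
Proof.
rewrite /S /series /= -sumEFin; apply: eq_bigr => m _.
by rewrite /cauchy_prod -sumEFin.
Qed.

Let integrable_S N : mu.-integrable D (fun x => (S N x)%:E).
Proof.
under eq_fun do rewrite SE.
by apply: integrable_sum => // m _; apply: integrable_sum.
Qed.

Let integral_S N : (\int[mu]_(x in D) (S N x)%:E =
  (series (fun m => convolution_coef alpha l c m * t `^ (m%:R * alpha)) N.+1)%:E)%E.
Proof.
under eq_integral do rewrite SE.
rewrite integral_sum//; last by move=> m; exact: integrable_sum.
rewrite series_recl convolution_coef0 mul0r add0r /series /= -sumEFin.
apply: eq_bigr => m _; rewrite integral_sum//.
under eq_bigr do rewrite integral_uv.
rewrite sumEFin; congr EFin; rewrite /convolution_coef big_add1 /= mulr_suml.
by apply: eq_big_nat => k /andP[_ km]; rewrite /K subSS subnKC.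
Qed.

Let C := frac_deriv_bound alpha c t *
  limn [normed series (mittag_leffler_term alpha (l * t `^ alpha))].

Let cvg_u (x : R) : D x -> cvgn [normed series (u x)].
Proof.
move=> /inD /andP[x0 xt]; apply: (normed_cvg_frac_deriv_term a0 cf).
by rewrite x0 (lt_trans xt).
Qed.

Let cvg_v x : cvgn [normed series (v x)].
Proof. exact: mittag_leffler_is_cvg. Qed.

Let le_S N (x : R) : D x -> `|S N x| <= C * x `^ (alpha - 1).
Proof.
move=> Dx; have /inD /andP[x0 xt] := Dx.
have h := le_cauchy_prod (cvg_u Dx) (@cvg_v x) N.
apply: (le_trans h).
rewrite /C mulrAC; apply: ler_pM.
- exact: normed_series_lim_ge0 (cvg_u Dx).
- exact: normed_series_lim_ge0 (@cvg_v x).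
- by apply: (le_frac_deriv_term a0 cf) => //; rewrite x0 ltW.
- by apply: le_mittag_leffler_term => //; apply/andP; split; lra.
Qed.

Let cvg_S (x : R) : D x -> S N x @[N --> \oo] -->
  derive1 f x * mittag_leffler alpha (l * (t - x) `^ alpha).
Proof.
move=> Dx; have /inD /andP[x0 xt] := Dx.
have := cvg_cauchy_prod (cvg_u Dx) (@cvg_v x).
have -> : limn (series (u x)) = derive1 f x; last by [].
apply/cvg_lim => //; apply: (derive_frac_series a0 cf).
by rewrite x0 (lt_trans xt).
Qed.

Let integrable_powR (C' : R) : mu.-integrable D (fun x => (C' * x `^ (alpha - 1))%:E).
Proof.
have := integrableZl mD C' (integrable_beta a0 ltr01 t0).
by apply: eq_integrable => // x _; rewrite subrr powRr0 mulr1 EFinM.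
Qed.

Let measurable_derive : measurable_fun D (derive1 f).
Proof.
apply: (measurable_fun_cvg (h := fun n x => series (u x) n)).
- move=> n; apply: measurable_sum => k.
  apply: measurable_funM; first exact: measurable_cst.
  exact: measurable_funTS.
- move=> x /inD /andP[x0 xt]; apply: (derive_frac_series a0 cf).
  by rewrite x0 (lt_trans xt).
Qed.

(** The derivative at the end point [0] is an arbitrary value, so the bound is
    used on the open interval and the end points are added as a null set. *)
Lemma integrable_derive_frac_series :
  (@lebesgue_measure R).-integrable `[0, t] (fun x => (derive1 f x)%:E).
Proof.
apply: integrable_itv_oo_cc.
apply: (le_integrable mD _ _ (integrable_powR (frac_deriv_bound alpha c t))).
  exact/measurable_EFinP.
move=> x Dx; have /inD /andP[x0 xt] := Dx.
rewrite /= lee_fin (le_trans _ (ler_norm _))//.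
apply: le_trans (le_frac_deriv_term a0 cf _ tT); last by rewrite x0 ltW.
have h : series (u x) @ \oo --> derive1 f x.
  by apply: (derive_frac_series a0 cf); rewrite x0 (lt_trans xt).
by rewrite -(cvg_lim _ h)//; apply: lim_series_norm; exact: cvg_u.
Qed.

(** Dominated convergence for the partial sums [S N] of the Cauchy product of the
    two series; their integrals are the partial sums [N.+1] of the series on
    the left, whose term of index [0] is zero. *)
Lemma cvg_derive_mittag_leffler_convolution :
  series (fun m => convolution_coef alpha l c m * t `^ (m%:R * alpha)) @ \oo -->
  \int[lebesgue_measure]_(x in `[0, t])
    (derive1 f x * mittag_leffler alpha (l * (t - x) `^ alpha)).
Proof.
pose F x := derive1 f x * mittag_leffler alpha (l * (t - x) `^ alpha).
have mS N : measurable_fun D (EFin \o S N) by have /integrableP[] := integrable_S N.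
have SF x : D x -> (EFin \o S N) x @[N --> \oo] --> (F x)%:E.
  by move=> Dx; apply: cvg_EFin; [exact: nearW|exact: cvg_S].
have bS N x : D x -> (`|(EFin \o S N) x| <= (C * x `^ (alpha - 1))%:E)%E.
  by move=> Dx; rewrite /= lee_fin le_S.
have fin x : D x -> (C * x `^ (alpha - 1))%:E \is a fin_num by [].
have dom := dominated_cvg mD mS SF fin (integrable_powR C) bS.
have mF : measurable_fun D F.
  by apply/measurable_EFinP; apply: (emeasurable_fun_cvg _ _ mS SF).
have iF : mu.-integrable D (EFin \o F).
  apply: (le_integrable mD _ _ (integrable_powR C)); first exact/measurable_EFinP.
  move=> x Dx; rewrite /= lee_fin (le_trans _ (ler_norm _))//.
  have h : `|S N x| @[N --> \oo] --> `|F x| by apply: cvg_norm; exact: cvg_S.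
  rewrite -(cvg_lim _ h)//; apply: limr_le; first by apply/cvg_ex; exists `|F x|.
  by apply: nearW => N; exact: le_S.
have -> : \int[lebesgue_measure]_(x in `[0, t]) F x = \int[mu]_(x in D) F x.
  rewrite /Rintegral (integral_itv_bndoo true false)//.
  exact/measurable_EFinP.
have finI : (\int[mu]_(x in D) F x)%:E = (\int[mu]_(x in D) (F x)%:E)%E.
  by rewrite /Rintegral fineK//; exact: integrable_fin_num.
move: dom; rewrite -finI => /fine_cvg.
rewrite (_ : fine \o _ = (fun N =>
  series (fun m => convolution_coef alpha l c m * t `^ (m%:R * alpha)) N.+1)); last first.
  by apply/funext => N /=; rewrite integral_S.
by rewrite (cvg_shiftS (series _)).
Qed.
End convolution.

(** * Real and imaginary parts *)

Section complex_parts.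
Variable R : realType.
Implicit Types (x y : R[i]) (r : R).

Lemma ReD x y : complex.Re (x + y) = complex.Re x + complex.Re y.
Proof. by case: x; case: y. Qed.

Lemma ImD x y : complex.Im (x + y) = complex.Im x + complex.Im y.
Proof. by case: x; case: y. Qed.

Lemma ReN x : complex.Re (- x) = - complex.Re x. Proof. by case: x. Qed.

Lemma ImN x : complex.Im (- x) = - complex.Im x. Proof. by case: x. Qed.

Lemma ReM x y : complex.Re (x * y) =
  complex.Re x * complex.Re y - complex.Im x * complex.Im y.
Proof. by case: x; case: y. Qed.

Lemma ImM x y : complex.Im (x * y) =
  complex.Re x * complex.Im y + complex.Im x * complex.Re y.
Proof. by case: x => ? ?; case: y. Qed.

Lemma ReMr x r : complex.Re (x * r%:C) = complex.Re x * r.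
Proof. by rewrite ReM /= mulr0 subr0. Qed.

Lemma ImMr x r : complex.Im (x * r%:C) = complex.Im x * r.
Proof. by rewrite ImM /= mulr0 add0r. Qed.

Lemma ReMl r x : complex.Re (r%:C * x) = r * complex.Re x.
Proof. by rewrite mulrC ReMr mulrC. Qed.

Lemma ImMl r x : complex.Im (r%:C * x) = r * complex.Im x.
Proof. by rewrite mulrC ImMr mulrC. Qed.

Lemma Re_sum (I : Type) (s : seq I) (P : pred I) (F : I -> R[i]) :
  complex.Re (\sum_(i <- s | P i) F i) = \sum_(i <- s | P i) complex.Re (F i).
Proof. exact: (big_morph _ ReD). Qed.

Lemma Im_sum (I : Type) (s : seq I) (P : pred I) (F : I -> R[i]) :
  complex.Im (\sum_(i <- s | P i) F i) = \sum_(i <- s | P i) complex.Im (F i).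
Proof. exact: (big_morph _ ImD). Qed.

Lemma complex_eqP x y : complex.Re x = complex.Re y -> complex.Im x = complex.Im y -> x = y.
Proof. by case: x => ? ?; case: y => ? ? /= -> ->. Qed.

Lemma normc_le_ReIm x : `|x| <= (`|complex.Re x| + `|complex.Im x|)%:C.
Proof.
rewrite normc_def lecR -[leRHS]ger0_norm ?addr_ge0// -sqrtr_sqr.
by rewrite ler_wsqrtr// sqrrD !real_normK ?num_real// lerD2r lerDl mulrn_wge0 ?mulr_ge0.
Qed.

Lemma normc_ge_Im x : `|complex.Im x|%:C <= `|x|.
Proof.
by rewrite normc_def lecR -sqrtr_sqr ler_wsqrtr// lerDr sqr_ge0.
Qed.

(** The topology of [R[i]^o] comes from the complex modulus, whose balls have
    radii [e : R[i]] with [0 < e]; such an [e] is a positive real. *)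
Lemma cvg_complexP (u : nat -> R[i]) (l : R[i]) :
  (u : nat -> R[i]^o) @ \oo --> (l : R[i]^o) <->
  (complex.Re (u n) @[n --> \oo] --> complex.Re l /\
   complex.Im (u n) @[n --> \oo] --> complex.Im l).
Proof.
split=> [/cvgrPdist_lt h|[/cvgrPdist_lt hr /cvgrPdist_lt hi]].
  split; apply/cvgrPdist_lt => e e0.
    have eC : 0 < e%:C by rewrite ltcR.
    apply: filterS (h _ eC) => n /= /(le_lt_trans (normc_ge_Re _)).
    by rewrite ltcR ReD ReN.
  have eC : 0 < e%:C by rewrite ltcR.
  apply: filterS (h _ eC) => n /= /(le_lt_trans (normc_ge_Im _)).
  by rewrite ltcR ImD ImN.
apply/cvgrPdist_lt => e e0.
have [r er] : exists r, e = r%:C by apply/complex_realP; rewrite gtr0_real.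
have r0 : 0 < r by move: e0; rewrite er ltcR.
have r20 : 0 < r / 2 by rewrite divr_gt0.
near=> n; rewrite er.
apply: (le_lt_trans (normc_le_ReIm _)); rewrite ltcR ReD ImD ReN ImN.
rewrite (splitr r) ltrD//.
  by near: n; exact: hr.
by near: n; exact: hi.
Unshelve. all: by end_near. Qed.

Lemma cvg_series_complexP (w : nat -> R[i]) (s : nat -> R) (l : R[i]) :
  series (fun k => w k * (s k)%:C : R[i]^o) @ \oo --> (l : R[i]^o) <->
  (series (fun k => complex.Re (w k) * s k) @ \oo --> complex.Re l /\
   series (fun k => complex.Im (w k) * s k) @ \oo --> complex.Im l).
Proof.
rewrite (cvg_complexP (series (fun k => w k * (s k)%:C)) l).
have -> : (fun n => complex.Re (series (fun k => w k * (s k)%:C) n)) =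
    series (fun k => complex.Re (w k) * s k).
  by apply/funext => n; rewrite /series /= Re_sum; apply: eq_bigr => k _; rewrite ReMr.
have -> // : (fun n => complex.Im (series (fun k => w k * (s k)%:C) n)) =
    series (fun k => complex.Im (w k) * s k).
by apply/funext => n; rewrite /series /= Im_sum; apply: eq_bigr => k _; rewrite ImMr.
Qed.

End complex_parts.

(** * Comparison of coefficients *)

Lemma eq_cvgn (V : topologicalType) (u v : nat -> V) (l : V) :
  v =1 u -> u @ \oo --> l -> v @ \oo --> l.
Proof. by move=> /funext ->. Qed.

Lemma cvg_frac_series_mul (R : realType) (alpha : R) (c d : R ^nat) (T : R)
    (g h : R -> R) : 0 < alpha ->
  (forall t, 0 <= t < T -> series (fun k : nat => c k * t `^ (k%:R * alpha)) @ \oo --> g t) ->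
  (forall t, 0 <= t < T -> series (fun k : nat => d k * t `^ (k%:R * alpha)) @ \oo --> h t) ->
  forall t, 0 <= t < T ->
    series (fun m : nat => cauchy_prod c d m * t `^ (m%:R * alpha)) @ \oo --> g t * h t.
Proof.
move=> a0 cg dh t tT.
have nc := normed_cvg_frac_series a0 cg tT.
have nd := normed_cvg_frac_series a0 dh tT.
have := cvg_cauchy_prod nc nd.
rewrite (cvg_lim _ (cg t tT))// (cvg_lim _ (dh t tT))//.
rewrite (_ : cauchy_prod _ _ = (fun m => cauchy_prod c d m * t `^ (m%:R * alpha)))//.
apply/funext => m; rewrite /cauchy_prod mulr_suml; apply: eq_big_nat => k /andP[_ km].
have {}km : (k <= m)%N by [].
have -> : t `^ (m%:R * alpha) = t `^ (k%:R * alpha) * t `^ ((m - k)%:R * alpha).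
  by rewrite !powR_natM -exprD subnKC.
by ring.
Qed.

(** Substitute [s = t `^ alpha] to reduce to power series on ]0, T `^ alpha[. *)
Lemma frac_series_eq0_coef (R : realType) (alpha : R) (c : R ^nat) (T : R) :
  0 < alpha -> 0 < T ->
  (forall t, 0 < t < T ->
    series (fun k : nat => c k * t `^ (k%:R * alpha)) @ \oo --> (0 : R)) ->
  forall m, c m = 0.
Proof.
move=> a0 T0 cT; apply: (@pseries_eq0_coef _ c (T `^ alpha)); first exact: powR_gt0.
move=> s /andP[s0 sT].
have sE : (s `^ alpha^-1) `^ alpha = s.
  by rewrite -powRrM mulVf ?gt_eqF// powRr1 ?ltW.
have := cT (s `^ alpha^-1); rewrite powR_gt0//=.
have -> : s `^ alpha^-1 < T.
  rewrite -[T](@powRr1 _ T) ?ltW// -(@mulfV _ alpha) ?gt_eqF// powRrM.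
  by apply: gt0_ltr_powR => //; rewrite ?invr_gt0 ?nnegrE ?powR_ge0// ltW.
move=> /(_ isT); rewrite /pseries.
rewrite (_ : (fun k : nat => _) = (fun k => c k * s ^+ k))//.
by apply/funext => k; rewrite powR_natM// sE.
Qed.

Section riccati.
Variables (R : realType) (B : R -> R) (alpha : R) (P Q : R[i]).
Hypothesis a0 : 0 < alpha.
Variables (a : nat -> R[i]) (T : R) (f : R -> R[i]).
Hypotheses (T0 : 0 < T) (fa : frac_series_on alpha a T f).

Let cfr (t : R) : 0 <= t < T ->
  series (fun k : nat => complex.Re (a k) * t `^ (k%:R * alpha)) @ \oo --> complex.Re (f t).
Proof. by move=> /fa /cvg_series_complexP[]. Qed.

Let cfi (t : R) : 0 <= t < T ->
  series (fun k : nat => complex.Im (a k) * t `^ (k%:R * alpha)) @ \oo --> complex.Im (f t).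
Proof. by move=> /fa /cvg_series_complexP[]. Qed.

Lemma frac_series_derivable : ABC_derivable T f.
Proof.
split; split=> t tT.
- by have [] := is_derive_frac_series a0 cfr tT.
- by have /andP[t0 t1] := tT; apply: (integrable_derive_frac_series a0 cfr).
- by have [] := is_derive_frac_series a0 cfi tT.
- by have /andP[t0 t1] := tT; apply: (integrable_derive_frac_series a0 cfi).
Qed.

Lemma frac_series0 : f 0 = a 0%N.
Proof.
have h0 : 0 <= (0 : R) < T by rewrite lexx.
have z (c : R ^nat) : series (fun k : nat => c k * 0 `^ (k%:R * alpha)) @ \oo --> c 0%N.
  rewrite -cvg_shiftS (_ : (fun n => _) = cst (c 0%N)); first exact: cvg_cst.
  apply/funext => n; rewrite series_recl powR_natM powR0 ?gt_eqF// expr0 mulr1.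
  by rewrite /series /= big1 ?addr0// => k _; rewrite powR_natM powR0 ?gt_eqF// expr0n mulr0.
apply: complex_eqP.
  exact: (cvg_unique _ (cfr h0) (z _)).
exact: (cvg_unique _ (cfi h0) (z _)).
Qed.

Definition ABC_coef (m : nat) : R[i] := (B alpha / (1 - alpha))%:C *
  \sum_(1 <= k < m.+1)
     a k * ((- alpha / (1 - alpha)) ^+ (m - k) *
            (Gamma (k%:R * alpha + 1) / Gamma (m%:R * alpha + 1)))%:C.

Let real_part (c : R ^nat) (g : R -> R) t :
  (forall t, 0 <= t < T -> series (fun k : nat => c k * t `^ (k%:R * alpha)) @ \oo --> g t) ->
  0 < t < T ->
  series (fun m => (B alpha / (1 - alpha) * convolution_coef alpha (- alpha / (1 - alpha)) c m) *
    t `^ (m%:R * alpha)) @ \oo --> ABC_derive_real B alpha g t.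
Proof.
move=> cg /andP[t0 tT].
have h := cvg_derive_mittag_leffler_convolution (l := - alpha / (1 - alpha)) a0 cg t0 tT.
rewrite /ABC_derive_real.
rewrite (_ : series _ = (fun n => B alpha / (1 - alpha) * series (fun m =>
  convolution_coef alpha (- alpha / (1 - alpha)) c m * t `^ (m%:R * alpha)) n)).
  by apply: cvgM => //; exact: cvg_cst.
by apply/funext => n; rewrite /series /= mulr_sumr; apply: eq_bigr => k _; rewrite mulrA.
Qed.

Lemma cvg_ABC_frac_series (t : R) : 0 < t < T ->
  series (fun m : nat => ABC_coef m * (t `^ (m%:R * alpha))%:C : R[i]^o) @ \oo -->
  (ABC_derive B alpha f t : R[i]^o).
Proof.
move=> tT; apply/cvg_series_complexP; split => /=.
  apply: eq_cvgn (real_part cfr tT) => n; apply: eq_bigr => m _.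
  congr (_ * _); rewrite /ABC_coef ReMl Re_sum; congr (_ * _).
  by apply: eq_bigr => k _; rewrite ReMr.
apply: eq_cvgn (real_part cfi tT) => n; apply: eq_bigr => m _.
congr (_ * _); rewrite /ABC_coef ImMl Im_sum; congr (_ * _).
by apply: eq_bigr => k _; rewrite ImMr.
Qed.

Lemma cvg_sqr_frac_series (t : R) : 0 <= t < T ->
  series (fun m : nat => cauchy_prod a a m * (t `^ (m%:R * alpha))%:C : R[i]^o) @ \oo -->
  (f t ^+ 2 : R[i]^o).
Proof.
move=> tT; apply/cvg_series_complexP.
have rr := cvg_frac_series_mul a0 cfr cfr tT.
have ii := cvg_frac_series_mul a0 cfi cfi tT.
have ri := cvg_frac_series_mul a0 cfr cfi tT.
have ir := cvg_frac_series_mul a0 cfi cfr tT.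
rewrite expr2 ReM ImM; split.
  apply: eq_cvgn (cvgB rr ii) => n; rewrite /series /= -[RHS]sumrB; apply: eq_bigr => k _.
  rewrite -mulrBl; congr (_ * _); rewrite /cauchy_prod Re_sum -sumrB.
  by apply: eq_bigr => j _; rewrite ReM.
apply: eq_cvgn (cvgD ri ir) => n; rewrite /series /= -[RHS]big_split; apply: eq_bigr => k _ /=.
rewrite -mulrDl; congr (_ * _); rewrite /cauchy_prod Im_sum -big_split.
by apply: eq_bigr => j _; rewrite ImM.
Qed.

(** The coefficients of [ABC_derive B alpha f t - Q * f t ^+ 2 - P] as a series
    in the powers of [t `^ alpha]. *)
Definition residual_coef (m : nat) : R[i] :=
  ABC_coef m - Q * cauchy_prod a a m - (if m == 0%N then P else 0).

Lemma cvg_residual (t : R) : 0 < t < T ->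
  series (fun m : nat => residual_coef m * (t `^ (m%:R * alpha))%:C : R[i]^o) @ \oo -->
  (ABC_derive B alpha f t - Q * f t ^+ 2 - P : R[i]^o).
Proof.
move=> tT; have tT' : 0 <= t < T by have /andP[t0 ->] := tT; rewrite ltW.
have h1 := cvg_ABC_frac_series tT.
have h2 := cvg_sqr_frac_series tT'.
have h3 : series (fun m : nat => (if m == 0%N then P else 0) * (t `^ (m%:R * alpha))%:C : R[i]^o)
    @ \oo --> (P : R[i]^o).
  rewrite -cvg_shiftS (_ : (fun n => _) = cst (P : R[i]^o)); first exact: cvg_cst.
  apply/funext => n; rewrite series_recl /= mul0r powRr0 mulr1.
  by rewrite /series /= big1 ?addr0// => k _; rewrite mul0r.
pose X := series (fun m : nat => ABC_coef m * (t `^ (m%:R * alpha))%:C).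
pose Y := series (fun m : nat => cauchy_prod a a m * (t `^ (m%:R * alpha))%:C).
pose Z := series (fun m : nat => (if m == 0%N then P else 0) * (t `^ (m%:R * alpha))%:C).
have h4 : (fun n => X n - Q * Y n - Z n : R[i]^o) @ \oo -->
    (ABC_derive B alpha f t - Q * f t ^+ 2 - P : R[i]^o).
  apply: cvgB h3; apply: cvgB h1 _.
  apply: cvgZr; exact: h2.
apply: (@eq_cvgn R[i]^o _ _ _ _ h4) => n.
rewrite /X /Y /Z /series /residual_coef /= mulr_sumr -!sumrB; apply: eq_bigr => k _.
by rewrite !mulrBl mulrA.
Qed.

(** The equation says that the series of the residual coefficients vanishes on
    ]0, T[, that is, that these coefficients are all zero. *)
Lemma riccati_solutionP (f0 : R[i]) :
  riccati_solution B alpha P Q f0 T f <->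
  riccati_identities B alpha P Q a /\ a 0%N = f0.
Proof.
have res0 : (forall m, residual_coef m = 0) <-> riccati_identities B alpha P Q a.
  rewrite /residual_coef /riccati_identities; split=> [h|[h0 hm] m].
    split=> [|m m0].
      have := h 0%N; rewrite /ABC_coef big_geq// mulr0 sub0r /cauchy_prod big_nat1 subn0.
      by move=> /eqP; rewrite subr_eq0 expr2 => /eqP <-; rewrite addNr.
    have := h m; rewrite gtn_eqF// subr0 => /eqP; rewrite subr_eq0 => /eqP.
    exact.
  case: ifPn => [/eqP ->|]; last first.
    rewrite -lt0n => m0; rewrite subr0; apply/eqP; rewrite subr_eq0; apply/eqP.
    exact: hm.
  rewrite /ABC_coef big_geq// mulr0 sub0r /cauchy_prod big_nat1 subn0.
  by rewrite -opprD addrC -expr2 -h0 oppr0.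
split.
  move=> [f0E _ eqn]; split; last by rewrite -frac_series0.
  apply/res0.
  have cR t : 0 < t < T ->
      series (fun m : nat => residual_coef m * (t `^ (m%:R * alpha))%:C : R[i]^o) @ \oo -->
      (0 : R[i]^o).
    move=> tT; have := cvg_residual tT; rewrite (eqn t tT).
    by rewrite addrK subrr.
  have re0 := @frac_series_eq0_coef R alpha (fun m => complex.Re (residual_coef m)) T a0 T0.
  have im0 := @frac_series_eq0_coef R alpha (fun m => complex.Im (residual_coef m)) T a0 T0.
  move=> m; apply: complex_eqP.
    by apply: re0 => t /cR /cvg_series_complexP[].
  by apply: im0 => t /cR /cvg_series_complexP[].
move=> [/res0 h a0E]; split.
- by rewrite frac_series0.
- exact: frac_series_derivable.
- move=> t tT; have := cvg_residual tT.
  have h0 : series (fun m : nat => residual_coef m * (t `^ (m%:R * alpha))%:C : R[i]^o) @ \oo -->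
      (0 : R[i]^o).
    apply: (@eq_cvgn R[i]^o (cst 0)); last exact: cvg_cst.
    by move=> n; rewrite /series /= big1// => m _; rewrite h mul0r.
  move=> h1; have e0 : ABC_derive B alpha f t - Q * f t ^+ 2 - P = 0.
    exact: (cvg_unique (@norm_hausdorff _ R[i]^o) h1 h0).
  by move/eqP: e0; rewrite subr_eq0 subr_eq => /eqP.
Qed.
End riccati.

(** * Solving the identities *)

Section riccati_algebra.
Variables (R : realType) (B : R -> R) (alpha : R) (P Q : R[i]).
Hypotheses (a0 : 0 < alpha) (Q0 : Q != 0).
Implicit Type a : nat -> R[i].

Lemma riccati_initialP (z : R[i]) :
  0 = P + Q * z ^+ 2 <-> z = sqrtC (- P / Q) \/ z = - sqrtC (- P / Q).
Proof.
have sE : Q * sqrtC (- P / Q) ^+ 2 = - P by rewrite sqrtCK mulrC divfK.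
split=> [h|[] ->]; last 2 first.
- by rewrite sE addrN.
- by rewrite sqrrN sE addrN.
have : z ^+ 2 == sqrtC (- P / Q) ^+ 2.
  rewrite -(inj_eq (mulfI Q0)) sE -subr_eq0 opprK addrC.
  by rewrite -h.
by rewrite eqf_sqr => /orP[/eqP ->|/eqP ->]; [left|right].
Qed.

(** The terms [k = 0] and [k = m] of the quadratic sum and the term [k = m] of
    the linear one contain [a m]; the others are those of the recurrence. *)
Lemma riccati_identityP a (m : nat) : (0 < m)%N ->
  2 * Q * a 0%N != (B alpha / (1 - alpha))%:C ->
  riccati_identity B alpha Q a m <-> a m = riccati_coef B alpha Q a m.
Proof.
move=> m0; rewrite /riccati_identity /riccati_coef.
(* The weights are abstracted: only [w m = 1] matters. *)
pose w k : R[i] := ((- alpha / (1 - alpha)) ^+ (m - k) *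
  (Gamma (k%:R * alpha + 1) / Gamma (m%:R * alpha + 1)))%:C.
have wm : w m = 1.
  have G0 : Gamma (m%:R * alpha + 1) != 0.
    by rewrite gt_eqF// Gamma_gt0// ltr_wpDl// mulr_ge0// ltW.
  by rewrite /w subnn (divff G0) expr0 (mulr1 (1 : R)).
move: (B alpha / (1 - alpha))%:C => b D0.
change (b * \sum_(1 <= k < m.+1) a k * w k =
    Q * \sum_(0 <= k < m.+1) a k * a (m - k)%N <->
  a m = (b * \sum_(1 <= k < m) a k * w k - Q * \sum_(1 <= k < m) a k * a (m - k)%N) /
    (2 * Q * a 0%N - b)).
clearbody w.
rewrite [X in b * X = _](big_nat_recr m 1 _ m0) /= wm mulr1.
rewrite [X in _ = Q * X <-> _]big_nat_recr//= subnn.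
rewrite [X in Q * (X + _)]big_ltn// subn0.
move: (\sum_(1 <= k < m) _) (\sum_(1 <= k < m) _) => S2 S1.
have D1 : 2 * Q * a 0%N - b != 0 by rewrite subr_eq0.
split=> [h|->].
  apply: (mulIf D1); rewrite divfK//.
  have -> : b * S1 = b * (S1 + a m) - b * a m by ring.
  by rewrite h; ring.
by field.
Qed.

Definition constant_coef (z : R[i]) (k : nat) : R[i] := if k == 0%N then z else 0.

Lemma constant_coef_identities (z : R[i]) : 0 = P + Q * z ^+ 2 ->
  riccati_identities B alpha P Q (constant_coef z).
Proof.
move=> h; split=> // m m0; rewrite /riccati_identity big_nat_cond big1 ?mulr0; last first.
  by move=> k /andP[/andP[k1 _] _]; rewrite /constant_coef gtn_eqF// mul0r.
rewrite big1 ?mulr0// => k _; rewrite /constant_coef.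
have [->|_] := eqVneq k 0%N; last by rewrite mul0r.
by rewrite subn0 gtn_eqF// mulr0.
Qed.

Lemma cvg_constant_series (z : R[i]) (T : R) :
  frac_series_on alpha (constant_coef z) T (fun=> z).
Proof.
move=> t tT; rewrite -cvg_shiftS; apply: (@eq_cvgn R[i]^o (cst z)); last exact: cvg_cst.
move=> n /=; rewrite series_recl /= mul0r powRr0 mulr1.
by rewrite /series /= big1 ?addr0// => k _; rewrite mul0r.
Qed.

(** By strong induction: each summand of the recurrence has a factor [a k] with
    [0 < k < m]. *)
Lemma riccati_coef_eq0 a : 2 * Q * a 0%N != (B alpha / (1 - alpha))%:C ->
  (forall m, (0 < m)%N -> a m = riccati_coef B alpha Q a m) ->
  a = constant_coef (a 0%N).
Proof.
move=> D0 h; suff az m : (0 < m)%N -> a m = 0.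
  by apply/funext => -[|m]; rewrite /constant_coef//= az.
elim/ltn_ind: m => m ih m0; rewrite h// /riccati_coef.
rewrite big_nat_cond big1 => [|k /andP[/andP[k1 km] _]]; last by rewrite ih// mul0r.
rewrite [X in _ - _ * X]big_nat_cond big1 => [|k /andP[/andP[k1 km] _]]; last first.
  by rewrite ih// mul0r.
by rewrite !mulr0 subr0 mul0r.
Qed.

(** For [n > 0] both partial sums of length [n] coincide, so the limits are
    compared along [n.+1]. *)
Lemma cvg_recurrence_seriesP a (x : nat -> R) (y : R[i]) : x 0%N = 1 ->
  (forall m, (0 < m)%N -> a m = riccati_coef B alpha Q a m) ->
  series (fun k : nat => a k * (x k)%:C : R[i]^o) @ \oo --> (y : R[i]^o) <->
  (a 0%N + \sum_(1 <= m < n) riccati_coef B alpha Q a m * (x m)%:C : R[i]^o)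
    @[n --> \oo] --> (y : R[i]^o).
Proof.
move=> x0 h.
rewrite -(cvg_shiftS (series _)).
rewrite -(cvg_shiftS (fun n : nat => (a 0%N +
  \sum_(1 <= m < n) riccati_coef B alpha Q a m * (x m)%:C : R[i]^o))).
have e n : series (fun k : nat => a k * (x k)%:C : R[i]^o) n.+1 =
    a 0%N + \sum_(1 <= m < n.+1) riccati_coef B alpha Q a m * (x m)%:C.
  rewrite series_recl x0 mulr1 /series /= big_add1; congr (_ + _).
  by apply: eq_bigr => k _; rewrite -h.
by split; apply: eq_cvgn => n /=; rewrite e.
Qed.
End riccati_algebra.

(** * The Riccati equation *)

Unset Implicit Arguments.

Theorem mainTheorem8 (R : realType) (B : R -> R) (alpha : R) (P Q : R[i])
    (Bpos : forall x : R, 0 <= x <= 1 -> 0 < B x)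
    (B0 : B 0 = 1) (B1 : B 1 = 1)
    (halpha : 0 < alpha < 1) (Q_neq0 : Q != 0) :
  (* a series is a solution iff its coefficients satisfy the identities *)
  (forall (f0 : R[i]) (a : nat -> R[i]) (T : R) (f : R -> R[i]),
     0 < T -> frac_series_on alpha a T f ->
     (riccati_solution B alpha P Q f0 T f <->
      riccati_identities B alpha P Q a /\ a 0%N = f0))
  /\
  (* there is a convergent series solution *)
  (forall f0 : R[i],
     f0 = sqrtC (- P / Q) \/ f0 = - sqrtC (- P / Q) ->
     exists (a : nat -> R[i]) (f : R -> R[i]),
       [/\ riccati_identities B alpha P Q a, a 0%N = f0 &
           forall T : R, 0 < T ->
             frac_series_on alpha a T f /\
             riccati_solution B alpha P Q f0 T f])
  /\
  (* the identities are solved for each m in turn *)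
  (forall a : nat -> R[i],
     (0 = P + Q * a 0%N ^+ 2 <->
      a 0%N = sqrtC (- P / Q) \/ a 0%N = - sqrtC (- P / Q)) /\
     (2 * Q * a 0%N != (B alpha / (1 - alpha))%:C ->
      forall m : nat, (0 < m)%N ->
        (riccati_identity B alpha Q a m <-> a m = riccati_coef B alpha Q a m)))
  /\
  (forall a0 : R[i],
     a0 = sqrtC (- P / Q) \/ a0 = - sqrtC (- P / Q) ->
     2 * Q * a0 != (B alpha / (1 - alpha))%:C ->
     exists! a : nat -> R[i],
       a 0%N = a0 /\ riccati_identities B alpha P Q a)
  /\
  (* the general solution of this form *)
  (forall (f0 : R[i]) (T : R) (f : R -> R[i]),
     0 < T -> 2 * Q * f0 != (B alpha / (1 - alpha))%:C ->
     ((exists a : nat -> R[i], frac_series_on alpha a T f) /\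
      riccati_solution B alpha P Q f0 T f
      <->
      (f0 = sqrtC (- P / Q) \/ f0 = - sqrtC (- P / Q)) /\
      exists a : nat -> R[i],
        [/\ a 0%N = f0,
            forall m : nat, (0 < m)%N -> a m = riccati_coef B alpha Q a m &
            forall t : R, 0 <= t < T ->
              (f0 + \sum_(1 <= m < n)
                 riccati_coef B alpha Q a m * (t `^ (m%:R * alpha))%:C : R[i]^o)
                @[n --> \oo] --> (f t : R[i]^o)])).
Proof.
have /andP[a0 a1] := halpha.
have part1 f0 a T f : 0 < T -> frac_series_on alpha a T f ->
    (riccati_solution B alpha P Q f0 T f <->
     riccati_identities B alpha P Q a /\ a 0%N = f0).
  by move=> T0 fa; exact: riccati_solutionP.
split; first exact: part1.
split.
  move=> f0 /(riccati_initialP P Q_neq0) f0E.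
  exists (constant_coef f0), (fun=> f0).
  have ids := constant_coef_identities B alpha f0E.
  split=> // T T0; have fa := @cvg_constant_series _ alpha f0 T.
  by split=> //; apply/(part1 _ _ _ _ T0 fa).
split.
  move=> a; split; first exact: riccati_initialP.
  by move=> D0 m m0; exact: riccati_identityP.
split.
  move=> z /(riccati_initialP P Q_neq0) zE D0.
  exists (constant_coef z); split.
    by split=> //; exact: constant_coef_identities.
  move=> a [az [_ ids]]; rewrite -az; apply/esym.
  apply: (@riccati_coef_eq0 _ B alpha Q); first by rewrite az.
  by move=> m m0; apply/riccati_identityP; rewrite ?az//; exact: ids.
move=> f0 T f T0 D0.
have x0 (t : R) : t `^ (0%:R * alpha) = 1 by rewrite mul0r powRr0.
split.
  move=> [[a fa] sol].
  have [[i0 ids] af0] := (part1 _ _ _ _ T0 fa).1 sol.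
  have rec m : (0 < m)%N -> a m = riccati_coef B alpha Q a m.
    by move=> m0; apply/riccati_identityP; rewrite ?af0//; exact: ids.
  split; first by apply/(riccati_initialP P Q_neq0); rewrite -af0.
  exists a; split=> // t tT.
  have := (cvg_recurrence_seriesP (f t) (x0 t) rec).1 (fa t tT).
  by rewrite af0.
move=> [/(riccati_initialP P Q_neq0) f0E [a [af0 rec cva]]].
have fa : frac_series_on alpha a T f.
  move=> t tT; apply/(cvg_recurrence_seriesP (f t) (x0 t) rec).
  by rewrite af0; exact: cva.
split; first by exists a.
apply/(part1 _ _ _ _ T0 fa); split=> //; split; first by rewrite af0.
by move=> m m0; apply/riccati_identityP; rewrite ?af0//; exact: rec.
Qed.
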